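(* Let $R=\mathbb K[x_1][x_2;\sigma_2,\delta_2]\cdots[x_N;\sigma_N,\delta_N]$ be a symmetric CGL extension of length $N$ with torus $\mathcal H$, and let $R_{N-1}$ be its subalgebra generated by $x_1,\dots,x_{N-1}$. Assume that $I$ and $J$ are two $\mathcal H$-prime ideals of $R$ and $R_{N-1}$, respectively, such that $$\mathcal{CD}_{\mathrm{rev}}(J)=\mathcal{CD}_{\mathrm{rev}}(I)\cap[1,N-1].$$ Then $J=I\cap R_{N-1}$.
   Context: $\mathbb K$ is an infinite field and $[a,b]$ denotes the set of integers between $a$ and $b$. CGL extensions. An iterated skew polynomial extension $R=\mathbb K[x_1][x_2;\sigma_2,\delta_2]\cdots[x_N;\sigma_N,\delta_N]$ is a Cauchon--Goodearl--Letzter (CGL) extension if it is equipped with a rational action of a $\mathbb K$-torus $\mathcal H$ by $\mathbb K$-algebra automorphisms such that: (i) $x_1,\dots,x_N$ are $\mathcal H$-eigenvectors; (ii) for every $k\in[2,N]$, $\delta_k$ is a locally nilpotent $\sigma_k$-derivation of $R_{k-1}$, where $R_k$ is the subalgebra generated by $x_1,\dots,x_k$ ($R_0=\mathbb K$); (iii) for every $k\in[1,N]$ there is $h_k\in\mathcal H$ such that $\sigma_k=(h_k\cdot)$ and the $h_k$-eigenvalue $\lambda_k\in\mathbb K^*$ of $x_k$ is not a root of unity. It is symmetric if it can also be presented as an iterated skew polynomial extension for the reverse order of its generators, $R=\mathbb K[x_N][x_{N-1};\sigma^*_{N-1},\delta^*_{N-1}]\cdots[x_1;\sigma^*_1,\delta^*_1]$,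 in such a way that conditions (ii)--(iii) hold for some choice of $h_N^*,\dots,h_1^*\in\mathcal H$. Then $R_{N-1}$ also has a reverse CGL presentation $R_{N-1}=\mathbb K[x_{N-1}][x_{N-2};\sigma^*_{N-2},\delta^*_{N-2}]\cdots[x_1;\sigma_1^*,\delta_1^*]$ (with restricted maps). All $\mathcal H$-prime ideals of a CGL extension are completely prime. Cauchon diagrams. For an $\mathcal H$-prime ideal $I$ of a CGL extension $R$ of length $N$ with generators adjoined in the order $x_1,\dots,x_N$, the Cauchon diagram $\mathcal{CD}(I)\subseteq[1,N]$ is defined recursively. If $x_N\in I$, then $\mathcal{CD}(I)=\mathcal{CD}(I\cap R_{N-1})\sqcup\{N\}$, where $I\cap R_{N-1}$ is an $\mathcal H$-prime ideal of $R_{N-1}$. If $x_N\notin I$, then $\mathcal{CD}(I)=\mathcal{CD}(\mathrm{lc}_{x_N}(I))$, where $\mathrm{lc}_{x_N}(I)$ is the set of leading coefficients (including $0$) of the elements of $I$ written as polynomials in $x_N$ with coefficients in $R_{N-1}$ on the left; it is an $\mathcal H$-prime ideal of $R_{N-1}$. For $R_0=\mathbb K$ the diagram of the zero ideal is $\varnothing$. Reverse diagrams. For an $\mathcal H$-prime ideal $I$ of the symmetric CGL extension $R$, $\mathcal{CD}_{\mathrm{rev}}(I)\subseteq[1,N]$ is the Cauchon diagram of $I$ with respect to the reverse presentation of $R$, where the indices recorded are those of the generators $x_k$ themselves (for example, if $Rx_1$ is a prime ideal then $\mathcal{CD}_{\mathrm{rev}}(Rx_1)=\{1\}$, not $\{N\}$).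 For an $\mathcal H$-prime ideal $J$ of $R_{N-1}$, $\mathcal{CD}_{\mathrm{rev}}(J)\subseteq[1,N-1]$ is defined in the same way using the reverse presentation of $R_{N-1}$. *)

(* Defs.v *)
From HB Require Import structures.
From mathcomp Require Import all_boot all_order all_algebra.
From mathcomp Require Import boolp classical_sets functions cardinality.

Set Implicit Arguments.
Unset Strict Implicit.
Unset Printing Implicit Defensive.

Import GRing.Theory.
Local Open Scope classical_set_scope.
Local Open Scope ring_scope.

Section Torus.
Variables (K : fieldType) (r : nat).

(* The torus (K^* )^r is the set of row vectors with nonzero entries under the
   entrywise product. *)
Definition torus : set 'rV[K]_r := [set h | forall i, h 0 i != 0].

Definition torus_mul (g h : 'rV[K]_r) : 'rV[K]_r := \row_i (g 0 i * h 0 i).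

Definition torus_one : 'rV[K]_r := const_mx 1.

(* Regular functions on the torus are given by Laurent polynomials, here lists
   of pairs (coefficient, exponent vector). *)
Definition regular_on_torus (f : 'rV[K]_r -> K) : Prop :=
  exists P : seq (K * 'rV[int]_r),
    forall h, torus h -> f h = \sum_(m <- P) m.1 * \prod_i h 0 i ^ m.2 0 i.

Variables (R : algType K) (act : 'rV[K]_r -> {lrmorphism R -> R}).

(* Only the values of [act] on the torus are meaningful. *)
Definition torus_action : Prop :=
  (forall a, act torus_one a = a) /\
  (forall g h a, torus g -> torus h -> act (torus_mul g h) a = act g (act h a)).

(* Every element lies in a finite-dimensional stable subspace, with basis v,
   on which the matrix coefficients C of the action are regular functions. *)
Definition rational_action : Prop :=
  forall a : R, exists (n : nat) (v : 'I_n -> R) (C : 'rV[K]_r -> 'M[K]_n),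
    [/\ forall c : 'I_n -> K, \sum_i c i *: v i = 0 -> forall i, c i = 0,
        exists c : 'I_n -> K, a = \sum_i c i *: v i,
        forall i j, regular_on_torus (fun h => C h i j) &
        forall h, torus h -> forall j, act h (v j) = \sum_i C h i j *: v i].

Definition torus_eigenvector (a : R) : Prop :=
  a != 0 /\ forall h, torus h -> exists lambda : K, act h a = lambda *: a.

Definition torus_stable (I : set R) : Prop :=
  forall h a, torus h -> I a -> I (act h a).

(* Two-sided ideals of a subalgebra A of R. *)
Definition ideal_of (A I : set R) : Prop :=
  [/\ I `<=` A, I 0, forall a b, I a -> I b -> I (a + b) &
      forall a b, A a -> I b -> I (a * b) /\ I (b * a)].

Definition H_prime (A I : set R) : Prop :=
  [/\ ideal_of A I, torus_stable I, ~ I 1 &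
      forall P Q : set R,
        ideal_of A P -> torus_stable P -> ideal_of A Q -> torus_stable Q ->
        (forall p q, P p -> Q q -> I (p * q)) -> P `<=` I \/ Q `<=` I].

End Torus.

Section SkewPolynomials.
Variables (K : fieldType) (R : algType K).

Definition subalgebra (S : set R) : Prop :=
  [/\ S 1, forall (c : K) a b, S a -> S b -> S (c *: a + b) &
      forall a b, S a -> S b -> S (a * b)].

Definition generated_subalgebra (X : set R) : set R :=
  [set a | forall S, subalgebra S -> X `<=` S -> S a].

(* Noncommutative evaluation p.[y] is \sum_i p`_i * y ^+ i, with the
   coefficients on the left. *)
Definition poly_over (A : set R) : set {poly R} := [set p | forall i, A p`_i].

Definition algebra_automorphism (A : set R) (sigma : R -> R) : Prop :=
  [/\ set_bij A A sigma, sigma 1 = 1,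
      forall (c : K) a b, A a -> A b ->
        sigma (c *: a + b) = c *: sigma a + sigma b &
      forall a b, A a -> A b -> sigma (a * b) = sigma a * sigma b].

Definition skew_derivation (A : set R) (sigma delta : R -> R) : Prop :=
  [/\ forall a, A a -> A (delta a),
      forall (c : K) a b, A a -> A b ->
        delta (c *: a + b) = c *: delta a + delta b &
      forall a b, A a -> A b -> delta (a * b) = sigma a * delta b + delta a * b].

Definition locally_nilpotent (A : set R) (delta : R -> R) : Prop :=
  forall a, A a -> exists n, iter n delta a = 0.

(* B = A[y; sigma, delta] inside R: B is a free left A-module on the powers of
   y, and y * a = sigma a * y + delta a.  The maps sigma and delta are only
   relevant on A. *)
Definition skew_polynomial_ring (A B : set R) (y : R) (sigma delta : R -> R) :
    Prop :=
  [/\ algebra_automorphism A sigma, skew_derivation A sigma delta,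
      forall a, A a -> y * a = sigma a * y + delta a,
      forall b, B b <-> exists2 p, poly_over A p & b = p.[y] &
      forall p, poly_over A p -> p.[y] = 0 -> p = 0].

Definition leading_coefs (A : set R) (y : R) (I : set R) : set R :=
  [set c | exists p, [/\ poly_over A p, I p.[y] & c = lead_coef p]].

End SkewPolynomials.

(* The generators are x 1, ..., x N; other values of x are irrelevant.  An order
   of adjunction is a list of indices whose head is the index adjoined last, so
   that k :: s stands for the skew polynomial ring over the algebra of s in the
   variable x k. *)
Section CGL.
Variables (K : fieldType) (R : algType K) (x : nat -> R).

Definition subalg (s : seq nat) : set R :=
  generated_subalgebra [set x k | k in [set k | k \in s]].

Section Presentation.
Variables (r : nat) (act : 'rV[K]_r -> {lrmorphism R -> R}).
Variables (sigma delta : nat -> R -> R).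

Definition CGL_element (k : nat) (A : set R) : Prop :=
  exists2 h, torus h &
    (forall a, A a -> sigma k a = act h a) /\
    exists lambda : K,
      [/\ act h (x k) = lambda *: x k, lambda != 0 &
          forall n, (0 < n)%N -> lambda ^+ n != 1].

(* For the generator adjoined first, the base is K itself, so that sigma is
   forced to be the identity and delta to be zero there. *)
Fixpoint CGL_presentation (s : seq nat) : Prop :=
  if s is k :: s' then
    [/\ CGL_presentation s',
        skew_polynomial_ring (subalg s') (subalg s) (x k) (sigma k) (delta k),
        locally_nilpotent (subalg s') (delta k) &
        CGL_element k (subalg s')]
  else True.

End Presentation.

Definition forward_order (N : nat) : seq nat := rev (iota 1 N).
Definition reverse_order (N : nat) : seq nat := iota 1 N.

Definition CGL_extension (N r : nat) (act : 'rV[K]_r -> {lrmorphism R -> R})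
    (sigma delta : nat -> R -> R) : Prop :=
  [/\ torus_action act, rational_action act,
      subalg (forward_order N) = setT,
      forall k, (1 <= k <= N)%N -> torus_eigenvector act (x k) &
      CGL_presentation act sigma delta (forward_order N)].

Definition symmetric_CGL_extension (N r : nat)
    (act : 'rV[K]_r -> {lrmorphism R -> R}) (sigma delta : nat -> R -> R) :
    Prop :=
  CGL_extension N act sigma delta /\
  exists sigma' delta' : nat -> R -> R,
    CGL_presentation act sigma' delta' (reverse_order N).

Fixpoint cauchon_diagram (s : seq nat) (I : set R) : set nat :=
  if s is k :: s' then
    if x k \in I then k |` cauchon_diagram s' (I `&` subalg s')
    else cauchon_diagram s' (leading_coefs (subalg s') (x k) I)
  else set0.

(* For an ideal of the subalgebra generated by x 1, ..., x n. *)
Definition reverse_cauchon_diagram (n : nat) (I : set R) : set nat :=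
  cauchon_diagram (reverse_order n) I.

End CGL.

(* Main.v *)
Require Import Defs.
From mathcomp Require Import all_boot all_order all_algebra.
From mathcomp Require Import boolp classical_sets functions cardinality.
From mathcomp Require Import ring.

Set Implicit Arguments.
Unset Strict Implicit.
Unset Printing Implicit Defensive.

Import GRing.Theory.
Local Open Scope classical_set_scope.
Local Open Scope ring_scope.

(* In a step B = A[y; s, d] with s the restriction of h, the elements f of B
   with y f = lambda^(-n) h(f) y are the homogeneous components of degree n of
   B[y^(-1)] for the grading given by Cauchon's deleting derivations.  If I is
   an H-prime ideal with y notin I, then I is stable under division by y and is
   spanned, after multiplication by a power of y, by components; a component
   lies in I exactly when its top coefficient lies in lc(I).  This shows that
   lc(I) is H-prime and that I is determined by lc(I).  If y is in I, then I is
   determined by I cap A.  Both facts are compatible with shrinking A to A',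
   which gives the theorem by induction along the reverse presentation, with
   A = K<x_(j+1), ..., x_N> and A' = K<x_(j+1), ..., x_(N-1)>.

   Division by y requires to exclude y^n in I when y notin I.  The contraction
   I cap A is completely prime: among the H-ideals X of A whose largest d-stable
   subideal is I cap A, a maximal one is H-prime, hence completely prime by
   induction on the length, and complete primeness passes to the d-stable core
   by the q-Leibniz rule.  Starting from 1 * y^n in I, the left Ore condition
   modulo I cap A then lowers the exponent until a nonzero constant of
   A / (I cap A) falls into I. *)

(** * Subspaces, ideals and graded sums *)

Section Subspaces.
Variables (K : fieldType) (R : algType K).
Implicit Types (A P Q X : set R) (F : nat -> set R).

(** The localisation B[y^(-1)] is never formed: its statements are read inside B after
    multiplication by a power of y, and the power is cancelled afterwards modulo a saturated ideal.
    Hence saturation must precede every comparison through lc.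

    That lambda is no root of unity enters through nu = lambda^(-1): distinct powers of nu separate
    degrees, the numbers nu^n - 1 are the denominators of the homogeneous lifts, and q-integers and
    Gaussian binomials at nu are nonzero in every characteristic.

    For y notin I, primeness of I does not pass to I cap A at once: the polynomials with
    coefficients in an H-ideal P of A form an ideal of B only if P is d-stable, so d-stable ideals
    alone are tested. This forces the detour through cores.

    A reverse presentation of R_(N-1) is not given; the derivation attached to x_j must be shown to
    preserve A'. It sends A' into A and into R_(N-1), and A cap R_(N-1) = A' follows from the last
    step of the forward presentation. *)

Definition subspace Q : Prop :=
  Q 0 /\ forall (c : K) a b, Q a -> Q b -> Q (c *: a + b).

Lemma subspaceD Q a b : subspace Q -> Q a -> Q b -> Q (a + b).
Proof. by move=> [_ QL] Qa Qb; rewrite -[a]scale1r; apply: QL. Qed.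

Lemma subspaceZ Q c a : subspace Q -> Q a -> Q (c *: a).
Proof. by move=> [Q0 QL] Qa; rewrite -[_ *: _]addr0; apply: QL. Qed.

Lemma subspaceN Q a : subspace Q -> Q a -> Q (- a).
Proof. by move=> sQ Qa; rewrite -scaleN1r; apply: subspaceZ. Qed.

Lemma subspaceB Q a b : subspace Q -> Q a -> Q b -> Q (a - b).
Proof. by move=> sQ Qa Qb; apply: subspaceD => //; apply: subspaceN. Qed.

Lemma subspace_addl Q a b : subspace Q -> Q a -> Q (a + b) -> Q b.
Proof.
by move=> sQ Qa Qab; rewrite -(addKr a b) addrC; apply: subspaceB.
Qed.

Lemma subspace_addr Q a b : subspace Q -> Q b -> Q (a + b) -> Q a.
Proof. by move=> sQ Qb; rewrite addrC; apply: subspace_addl. Qed.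

Lemma subspaceZ_inv Q (c : K) a : subspace Q -> c != 0 -> Q (c *: a) -> Q a.
Proof.
move=> sQ c0 /(subspaceZ c^-1 sQ); by rewrite scalerA mulVf // scale1r.
Qed.

Lemma subspace_sum Q (I : Type) (r : seq I) (S : pred I) (f : I -> R) :
  subspace Q -> (forall i, S i -> Q (f i)) -> Q (\sum_(i <- r | S i) f i).
Proof.
move=> sQ Qf; elim/big_ind: _ => //; first by case: sQ.
by move=> a b; apply: subspaceD.
Qed.

Lemma subspaceI P Q : subspace P -> subspace Q -> subspace (P `&` Q).
Proof.
move=> [P0 PL] [Q0 QL]; split => // c a b [Pa Qa] [Pb Qb].
by split; [apply: PL | apply: QL].
Qed.

Lemma subspace_preim (f : {linear R -> R}) Q :
  subspace Q -> subspace [set a | Q (f a)].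
Proof.
move=> sQ; split=> [|c a b] /=; first by rewrite linear0; case: sQ.
by rewrite linearP; case: sQ => _; apply.
Qed.

Definition sums F (n : nat) : set R :=
  [set b | exists2 f : nat -> R, (forall i, F i (f i)) & b = \sum_(i < n) f i].

Section Sums.
Variable F : nat -> set R.
Hypothesis sF : forall i, subspace (F i).

Lemma subspace_sums n : subspace (sums F n).
Proof.
split.
  exists (fun _ => 0); first by move=> i; case: (sF i).
  by rewrite big1.
move=> c a b [f Ff ->] [g Fg ->]; exists (fun i => c *: f i + g i).
  by move=> i; case: (sF i) => _; apply.
by rewrite scaler_sumr big_split.
Qed.

Lemma sums_mono m n b : (m <= n)%N -> sums F m b -> sums F n b.
Proof.
move=> mn [f Ff ->]; exists (fun i => if (i < m)%N then f i else 0).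
  by move=> i; case: ifP => // _; case: (sF i).
rewrite -big_mkcond (big_ord_widen n f mn) /=.
by apply: eq_bigl => i.
Qed.

Lemma sums_mem n i b : (i < n)%N -> F i b -> sums F n b.
Proof.
move=> lt_in Fb; exists (fun j => if j == i then b else 0).
  by move=> j; case: eqP => [->|_] //; case: (sF j).
rewrite -big_mkcond (bigD1 (Ordinal lt_in)) //= big1 ?addr0 // => j.
by case/andP=> /eqP ji; rewrite -val_eqE /= => /eqP.
Qed.

Lemma sums_sub n Q : subspace Q -> (forall i, (i < n)%N -> F i `<=` Q) ->
  sums F n `<=` Q.
Proof.
move=> sQ FQ _ [f Ff ->]; apply: subspace_sum => // i _.
exact: (FQ i).
Qed.

Lemma sumsS n b :
  sums F n.+1 b -> exists a c, [/\ sums F n a, F n c & b = a + c].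
Proof.
move=> [f Ff ->]; exists (\sum_(i < n) f i), (f n); split=> //.
  by exists f.
by rewrite big_ord_recr.
Qed.

Lemma sums0 b : sums F 0 b -> b = 0.
Proof. by case=> f _ ->; rewrite big_ord0. Qed.

Lemma sums_map (f : {linear R -> R}) Q n : subspace Q ->
  (forall i b, (i < n)%N -> F i b -> Q (f b)) ->
  forall b, sums F n b -> Q (f b).
Proof.
move=> sQ FQ; apply: (@sums_sub n [set b | Q (f b)]).
  exact: subspace_preim.
by move=> i lt_in b; apply: FQ.
Qed.

End Sums.

Lemma subspace_mull Q a : subspace Q -> subspace [set b | Q (a * b)].
Proof.
move=> [Q0 QL]; split=> [|c u v] /=; first by rewrite mulr0.
by rewrite mulrDr -scalerAr; apply: QL.
Qed.

Lemma subspace_mulr Q a : subspace Q -> subspace [set b | Q (b * a)].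
Proof.
move=> [Q0 QL]; split=> [|c u v] /=; first by rewrite mul0r.
by rewrite mulrDl -scalerAl; apply: QL.
Qed.

Lemma sums_mul F F' Q m n a b :
    (forall i, subspace (F i)) -> (forall i, subspace (F' i)) -> subspace Q ->
    (forall i j u v, (i < m)%N -> (j < n)%N -> F i u -> F' j v -> Q (u * v)) ->
  sums F m a -> sums F' n b -> Q (a * b).
Proof.
move=> sF sF' sQ FQ Fa Fb; move: a Fa.
apply: (sums_sub _ (Q := [set a | Q (a * b)])); first exact: subspace_mulr.
move=> i lt_im a Fa /=; move: b Fb.
apply: (sums_sub _ (Q := [set b | Q (a * b)])); first exact: subspace_mull.
by move=> j lt_jn b Fb; apply: FQ Fa Fb.
Qed.

Lemma subalgebra_subspace A : subalgebra A -> subspace A.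
Proof.
move=> [A1 AL _]; split=> //; rewrite -(subrr (1 : R)) -scaleN1r addrC.
exact: AL.
Qed.

Lemma ideal_subspace A Q : subalgebra A -> ideal_of A Q -> subspace Q.
Proof.
move=> sA [_ Q0 QD QM]; split=> // c a b Qa Qb; apply: QD => //.
rewrite -mulr_algl; apply: (QM _ _ _ Qa).1.
by apply: (subspaceZ _ (subalgebra_subspace sA)); case: sA.
Qed.

Lemma ideal_sum A P Q : ideal_of A P -> ideal_of A Q -> subalgebra A ->
  ideal_of A [set b | exists p q, [/\ P p, Q q & b = p + q]].
Proof.
move=> [PA P0 PD PM] [QA Q0 QD QM] sA; split.
- move=> _ [p [q [Pp Qq ->]]].
  by apply: (subspaceD (subalgebra_subspace sA)); auto.
- by exists 0, 0; rewrite addr0.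
- move=> _ _ [p [q [Pp Qq ->]]] [p' [q' [Pp' Qq' ->]]].
  by exists (p + p'), (q + q'); rewrite addrACA; split; auto.
- move=> a _ Aa [p [q [Pp Qq ->]]]; have [? ?] := PM _ _ Aa Pp.
  have [? ?] := QM _ _ Aa Qq; split.
  + by exists (a * p), (a * q); rewrite mulrDr.
  + by exists (p * a), (q * a); rewrite mulrDl.
Qed.

Lemma subalgebra_generated X : subalgebra (generated_subalgebra X).
Proof.
split=> [S|c a b Xa Xb S|a b Xa Xb S] sS XS.
- by case: sS.
- by case: (sS) => _ h _; apply: h; [apply: Xa | apply: Xb].
- by case: (sS) => _ _; apply; [apply: Xa | apply: Xb].
Qed.

Lemma subset_generated X : X `<=` generated_subalgebra X.
Proof. by move=> a Xa S _; apply. Qed.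

Lemma subalgebra_X A a n : subalgebra A -> A a -> A (a ^+ n).
Proof.
move=> [A1 _ AM] Aa; elim: n => [|n IH]; first by rewrite expr0.
by rewrite exprS; apply: AM.
Qed.

Definition left_ideal A Q : Prop :=
  [/\ Q `<=` A, subspace Q & forall a b, A a -> Q b -> Q (a * b)].

Definition left_noetherian A : Prop :=
  forall M : nat -> set R, (forall k, left_ideal A (M k)) ->
    (forall k, M k `<=` M k.+1) ->
  exists n, forall m, (n <= m)%N -> M m `<=` M n.

Lemma chain_le (M : nat -> set R) : (forall k, M k `<=` M k.+1) ->
  forall m n, (m <= n)%N -> M m `<=` M n.
Proof.
move=> MS m n /subnK <-; elim: (n - m)%N => [|k IH] //.
by apply: subset_trans IH _; rewrite addSn.
Qed.

Definition completely_prime A Q : Prop :=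
  ~ Q 1 /\ forall a b, A a -> A b -> Q (a * b) -> Q a \/ Q b.

End Subspaces.
(** * Skew polynomial extensions with a torus action *)

Section Torus.
Variables (K : fieldType) (r : nat).
Implicit Types g h : 'rV[K]_r.

Definition torus_inv h : 'rV[K]_r := \row_i (h 0 i)^-1.

Lemma torus_invP h : torus h -> torus (torus_inv h).
Proof. by move=> th i; rewrite mxE invr_eq0. Qed.

Lemma torus_mulV h : torus h -> torus_mul h (torus_inv h) = torus_one K r.
Proof. by move=> th; apply/rowP => i; rewrite !mxE divff. Qed.

Lemma torus_mulC g h : torus_mul g h = torus_mul h g.
Proof. by apply/rowP => i; rewrite !mxE mulrC. Qed.

Variables (R : algType K) (act : 'rV[K]_r -> {lrmorphism R -> R}).
Hypothesis act_torus : torus_action act.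

Lemma actK h : torus h -> cancel (act h) (act (torus_inv h)).
Proof.
move=> th a; case: act_torus => act1 actM.
rewrite -actM //; last exact: torus_invP.
by rewrite torus_mulC torus_mulV // act1.
Qed.

Lemma actVK h : torus h -> cancel (act (torus_inv h)) (act h).
Proof.
move=> th a; case: act_torus => act1 actM.
rewrite -actM //; last exact: torus_invP.
by rewrite torus_mulV // act1.
Qed.

Lemma actC g h a : torus g -> torus h -> act g (act h a) = act h (act g a).
Proof.
by move=> tg th; case: act_torus => _ actM; rewrite -!actM // torus_mulC.
Qed.

Lemma torus_eigenvalue y g : torus_eigenvector act y -> torus g ->
  exists2 mu : K, mu != 0 & act g y = mu *: y.
Proof.
move=> [y0 ey] tg; have [mu emu] := ey g tg; exists mu => //.
apply: contra_neq y0 => mu0; rewrite -(actK tg y) emu mu0 scale0r.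
exact: linear0.
Qed.

End Torus.

Section Skew.
Variables (K : fieldType) (R : algType K) (r : nat).
Variable act : 'rV[K]_r -> {lrmorphism R -> R}.

Definition monomials (y : R) (U : set R) (i : nat) : set R :=
  [set b | exists2 a, U a & b = a * y ^+ i].

(** Polynomials of degree less than [n] with left coefficients. [U] will be the base, a subalgebra
    of it, or an ideal. *)
Definition polys y U n : set R := sums (monomials y U) n.

(** On the base this is the derivation of the extension. Being defined on all of [R] by [h] and [y]
    alone, it restricts to smaller bases without transport of a map. *)
Definition skew_der (h : 'rV[K]_r) (y a : R) : R := y * a - act h a * y.

(** Freeness appears in the last field as uniqueness of the top coefficient; the lower coefficients
    follow by descent on the degree. *)
Record skew_extension
    (h : 'rV[K]_r) (lambda : K) (A B : set R) (y : R) : Prop :=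
  SkewExtension {
    skew_torus : torus h;
    skew_eigen : torus_eigenvector act y;
    skew_eigenvalue : act h y = lambda *: y;
    skew_lambda_neq0 : lambda != 0;
    skew_lambda_root : forall n, (0 < n)%N -> lambda ^+ n != 1;
    skew_subalgebra : subalgebra A;
    skew_stable : torus_stable act A;
    skew_der_stable : forall a, A a -> A (skew_der h y a);
    skew_der_nilpotent :
      forall a, A a -> exists n, iter n (skew_der h y) a = 0;
    skew_polys : forall b, B b <-> exists n, polys y A n b;
    skew_free : forall n a, A a -> polys y A n (a * y ^+ n) -> a = 0
  }.

Variables (h : 'rV[K]_r) (lambda : K) (A B : set R) (y : R).
Hypothesis act_torus : torus_action act.
Hypothesis AB : skew_extension h lambda A B y.

Notation s := (act h).
Notation si := (act (torus_inv h)).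
Notation d := (skew_der h y).
Notation nu := (lambda^-1).

Let th : torus h := skew_torus AB.
Let sA : subalgebra A := skew_subalgebra AB.
Let sAs : subspace A := subalgebra_subspace sA.
Let A1 : A 1. Proof. by case: sA. Qed.
Let AM a b : A a -> A b -> A (a * b).
Proof. by case: sA => _ _; apply. Qed.
Let As a : A a -> A (s a).
Proof. by move=> Aa; apply: (skew_stable AB). Qed.
Let Asi a : A a -> A (si a).
Proof. by move=> Aa; apply: (skew_stable AB) => //; apply: torus_invP. Qed.
Let Ad a : A a -> A (d a) := @skew_der_stable _ _ _ _ _ AB a.

Lemma nu_neq0 : nu != 0.
Proof. by rewrite invr_eq0 (skew_lambda_neq0 AB). Qed.

Lemma nu_root n : (0 < n)%N -> nu ^+ n != 1.
Proof.
by move=> n0; rewrite exprVn -invr1 (inj_eq invr_inj) (skew_lambda_root AB).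
Qed.

Lemma nu_inj m n : nu ^+ m = nu ^+ n -> m = n.
Proof.
wlog le_mn : m n / (m <= n)%N.
  by move=> H e; case: (leqP m n) => [|/ltnW] le; [|symmetry]; apply: H.
rewrite -(subnKC le_mn) exprD -[LHS]mulr1.
move=> /(mulfI (expf_neq0 m nu_neq0)) /esym/eqP.
case: (posnP (n - m)) => [->|]; first by rewrite addn0.
by move=> /nu_root/negbTE ->.
Qed.

Lemma mulyE a : y * a = s a * y + d a.
Proof. by rewrite /skew_der addrC subrK. Qed.

Lemma skew_der_linear (c : K) a b : d (c *: a + b) = c *: d a + d b.
Proof.
rewrite /skew_der linearP mulrDr mulrDl -scalerAr -scalerAl scalerBr.
by rewrite opprD addrACA.
Qed.

Lemma skew_der0 : d 0 = 0.
Proof. by rewrite /skew_der linear0 mulr0 mul0r subrr. Qed.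

Lemma skew_derZ c a : d (c *: a) = c *: d a.
Proof. by rewrite -[c *: a]addr0 skew_der_linear skew_der0 addr0. Qed.

Lemma skew_derD a b : d (a + b) = d a + d b.
Proof. by rewrite -[a in LHS]scale1r skew_der_linear scale1r. Qed.

Lemma iter_skew_der0 n : iter n d 0 = 0.
Proof. by elim: n => //= n ->; apply: skew_der0. Qed.

Lemma iter_skew_der_linear n (c : K) a b :
  iter n d (c *: a + b) = c *: iter n d a + iter n d b.
Proof. by elim: n => //= n ->; apply: skew_der_linear. Qed.

Lemma skew_derM a b : d (a * b) = s a * d b + d a * b.
Proof.
rewrite /skew_der rmorphM mulrBr mulrBl !mulrA.
by rewrite [RHS]addrC addrA subrK.
Qed.

Lemma skew_der_act g a : torus g ->
  exists2 mu : K, mu != 0 & act g (d a) = mu *: d (act g a).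
Proof.
move=> tg; have [mu mu0 e] := torus_eigenvalue act_torus (skew_eigen AB) tg.
exists mu => //; rewrite /skew_der linearB /= !rmorphM /= e actC //.
by rewrite scalerBr -scalerAl -scalerAr.
Qed.

Lemma iter_skew_der_act n g a : torus g ->
  exists2 mu : K, mu != 0 & iter n d (act g a) = mu *: act g (iter n d a).
Proof.
move=> tg; elim: n => [|n [mu mu0 IH]] /=.
  by exists 1; rewrite ?oner_eq0 ?scale1r.
have [mu' mu'0 e] := skew_der_act (iter n d a) tg.
exists (mu / mu'); first by rewrite mulf_neq0 ?invr_eq0.
by rewrite IH skew_derZ e scalerA mulfVK.
Qed.

(** [h] scales [y] by [lambda], which makes [d] a q-skew derivation; the q-numbers below come from
    this relation. *)
Lemma s_skew_der a : s (d a) = lambda *: d (s a).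
Proof.
rewrite /skew_der linearB /= !rmorphM /= (skew_eigenvalue AB).
by rewrite scalerBr -scalerAl -scalerAr.
Qed.

Lemma skew_der_s a : d (s a) = nu *: s (d a).
Proof. by rewrite s_skew_der scalerA mulVf ?scale1r ?(skew_lambda_neq0 AB). Qed.

Lemma skew_der_si a : d (si a) = lambda *: si (d a).
Proof.
rewrite -[a in RHS](actVK act_torus th) skew_der_s linearZ /= scalerA.
by rewrite mulfV ?(skew_lambda_neq0 AB) // scale1r (actK act_torus th).
Qed.

Lemma si_y : si y = nu *: y.
Proof.
apply: (can_inj (actK act_torus th)); rewrite (actVK act_torus th) linearZ /=.
by rewrite (skew_eigenvalue AB) scalerA mulVf ?scale1r ?(skew_lambda_neq0 AB).
Qed.

Lemma iter_s_A n a : A a -> A (iter n s a).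
Proof. by move=> Aa; elim: n => //= n; apply: As. Qed.

Lemma iter_s_stable n P a : torus_stable act P -> P a -> P (iter n s a).
Proof. by move=> sP Pa; elim: n => //= n; apply: sP. Qed.

Lemma iter_si_stable n P a : torus_stable act P -> P a -> P (iter n si a).
Proof. by move=> sP Pa; elim: n => //= n; apply: sP; apply: torus_invP. Qed.

Lemma iter_sK n : cancel (iter n s) (iter n si).
Proof.
elim: n => // n IH a; rewrite iterSr /= (actK act_torus th); exact: IH.
Qed.

Lemma iter_siK n : cancel (iter n si) (iter n s).
Proof.
elim: n => // n IH a; rewrite iterSr /= (actVK act_torus th); exact: IH.
Qed.

Lemma iter_s0 n : iter n s 0 = 0.
Proof. by elim: n => //= n ->; apply: linear0. Qed.

Lemma iter_sD n a b : iter n s (a + b) = iter n s a + iter n s b.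
Proof. by elim: n => //= n ->; apply: linearD. Qed.

Lemma iter_sZ n c a : iter n s (c *: a) = c *: iter n s a.
Proof. by elim: n => //= n ->; rewrite linearZ. Qed.

Lemma iter_sM n a b : iter n s (a * b) = iter n s a * iter n s b.
Proof. by elim: n => //= n ->; rewrite rmorphM. Qed.

Lemma iter_s_der n a : d (iter n s a) = nu ^+ n *: iter n s (d a).
Proof.
elim: n => [|n IH] /=; first by rewrite scale1r.
by rewrite skew_der_s IH linearZ scalerA -exprS.
Qed.

Section Polys.
Implicit Types (U V W : set R).

Lemma subspace_monomials U i : subspace U -> subspace (monomials y U i).
Proof.
move=> [U0 UL]; split; first by exists 0; rewrite ?mul0r.
move=> c _ _ [a Ua ->] [b Ub ->]; exists (c *: a + b); first exact: UL.
by rewrite mulrDl scalerAl.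
Qed.

Lemma subspace_polys U n : subspace U -> subspace (polys y U n).
Proof. by move=> sU; apply: subspace_sums => i; apply: subspace_monomials. Qed.

Lemma polys_mono U m n b : subspace U -> (m <= n)%N ->
  polys y U m b -> polys y U n b.
Proof. by move=> sU; apply: sums_mono => i; apply: subspace_monomials. Qed.

Lemma polys_monomial U n i a : (i < n)%N -> U a -> subspace U ->
  polys y U n (a * y ^+ i).
Proof.
move=> lt_in Ua sU; apply: (sums_mem _ lt_in); last by exists a.
by move=> j; apply: subspace_monomials.
Qed.

Lemma polys_coef U n a : subspace U -> U a -> polys y U n.+1 a.
Proof. by move=> sU Ua; rewrite -[a]mulr1 -(expr0 y);
  apply: polys_monomial. Qed.

Lemma polys_ind U n (Q : set R) : subspace Q ->
    (forall i a, (i < n)%N -> U a -> Q (a * y ^+ i)) ->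
  polys y U n `<=` Q.
Proof.
by move=> sQ UQ; apply: sums_sub => // i lt_in _ [a Ua ->]; apply: UQ.
Qed.

Lemma polysS U n b : polys y U n.+1 b ->
  exists c a, [/\ polys y U n c, U a & b = c + a * y ^+ n].
Proof. by move=> /sumsS[c [_ [? [a Ua ->] ->]]]; exists c, a. Qed.

Lemma polys_y U n m b : subspace U -> polys y U n b ->
  polys y U (n + m) (b * y ^+ m).
Proof.
move=> sU; move: b.
apply: (@polys_ind U n [set b | polys y U (n + m) (b * y ^+ m)]).
  exact/subspace_mulr/subspace_polys.
move=> i a lt_in Ua /=; rewrite -mulrA -exprD.
by apply: polys_monomial => //; rewrite ltn_add2r.
Qed.

Lemma polys_sub U V n b : (U `<=` V) -> polys y U n b -> polys y V n b.
Proof.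
move=> UV [f Uf ->]; exists f => // i.
by have [a Ua ->] := Uf i; exists a => //; apply: UV.
Qed.

Lemma y_polys U n m b : subspace U ->
    (forall a, U a -> U (s a)) -> (forall a, U a -> U (d a)) ->
  polys y U n b -> polys y U (m + n) (y ^+ m * b).
Proof.
move=> sU Us Ud; elim: m => [|m IH] Ub; first by rewrite mul1r.
rewrite exprS -mulrA addSn; move: (y ^+ m * b) (IH Ub).
apply: (@polys_ind U (m + n) [set c | polys y U (m + n).+1 (y * c)]).
  exact/subspace_mull/subspace_polys.
move=> i a lt_i Ua /=; rewrite mulrA mulyE mulrDl -mulrA -exprS.
apply: (subspaceD (subspace_polys _ sU)).
  by apply: polys_monomial => //; apply: Us.
by apply: polys_monomial => //; [apply: ltnW | apply: Ud].
Qed.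

Lemma coef_polys U W a n b : subspace W -> (forall u, U u -> W (a * u)) ->
  polys y U n b -> polys y W n (a * b).
Proof.
move=> sW UW; move: b.
apply: (@polys_ind U n [set b | polys y W n (a * b)]).
  exact/subspace_mull/subspace_polys.
by move=> i u lt_i Uu /=; rewrite mulrA; apply: polys_monomial => //; apply: UW.
Qed.

Lemma polys_mul U V W m n a b : subspace V -> subspace W ->
    (forall a, V a -> V (s a)) -> (forall a, V a -> V (d a)) ->
    (forall u v, U u -> V v -> W (u * v)) ->
  polys y U m a -> polys y V n.+1 b -> polys y W (m + n) (a * b).
Proof.
move=> sV sW Vs Vd UVW Ua Vb; move: a Ua.
apply: (@polys_ind U m [set a | polys y W (m + n) (a * b)]).
  exact/subspace_mulr/subspace_polys.
move=> i u lt_im Uu /=; rewrite -mulrA.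
apply: (coef_polys sW (fun v => UVW u v Uu)).
apply: (@polys_mono V (i + n.+1)) => //; first by rewrite addnS ltn_add2r.
exact: y_polys.
Qed.

End Polys.

Let polysA n : subspace (polys y A n). Proof. exact: subspace_polys. Qed.

Lemma skew_incl a : A a -> B a.
Proof. by move=> Aa; apply/(skew_polys AB); exists 1; apply: polys_coef. Qed.

Lemma subspace_skew : subspace B.
Proof.
split; first by apply: skew_incl; case: sAs.
move=> c a b /(skew_polys AB)[m Pa] /(skew_polys AB)[n Pb].
apply/(skew_polys AB); exists (maxn m n).
case: (polysA (maxn m n)) => _; apply.
  by apply: polys_mono Pa; rewrite ?leq_maxl.
by apply: polys_mono Pb; rewrite ?leq_maxr.
Qed.

Lemma subalgebra_skew : subalgebra B.
Proof.
split; first exact: skew_incl.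
  by case: subspace_skew.
move=> a b /(skew_polys AB)[m Pa] /(skew_polys AB)[n Pb].
apply/(skew_polys AB); exists (m + n)%N.
apply: (@polys_mul A A A) => //; exact: polys_mono Pb.
Qed.

Let BM a b : B a -> B b -> B (a * b).
Proof. by case: subalgebra_skew => _ _; apply. Qed.

Lemma skew_polys_incl n : polys y A n `<=` B.
Proof. by move=> b Pb; apply/(skew_polys AB); exists n. Qed.

Lemma skew_y : B y.
Proof.
apply: (@skew_polys_incl 2).
by have := polys_monomial (ltnSn 1) A1 sAs; rewrite mul1r expr1.
Qed.

Lemma polys_act n g b : torus g -> polys y A n b -> polys y A n (act g b).
Proof.
move=> tg; move: b.
apply: (@polys_ind A n [set b | polys y A n (act g b)]).
  exact/subspace_preim/polysA.
have [mu _ e] := torus_eigenvalue act_torus (skew_eigen AB) tg.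
move=> i a lt_in Aa /=; rewrite rmorphM rmorphXn /= e exprZn -scalerAr.
apply: (subspaceZ _ (polysA n)); apply: polys_monomial => //.
exact: (skew_stable AB).
Qed.

Lemma skew_torus_stable : torus_stable act B.
Proof.
move=> g b tg /(skew_polys AB)[n Pb]; apply: (@skew_polys_incl n).
exact: polys_act.
Qed.

Lemma commy_polys n a : A a -> polys y A n (y ^+ n * a - iter n s a * y ^+ n).
Proof.
move=> Aa; elim: n => [|n IH].
  by rewrite mul1r mulr1 subrr; case: (polysA 0).
have /(subspaceD (polysA n.+1)) := @y_polys A n 1 _ sAs As Ad IH.
rewrite mulrBr !mulrA -!exprS mulyE mulrDl -mulrA -exprS expr1 opprD.
move/(_ (d (iter n s a) * y ^+ n)); rewrite addrA subrK; apply.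
by apply: polys_monomial => //; apply/Ad/iter_s_A.
Qed.

(** The degree [n] is formal, since [a] may be 0. Top coefficients are thereby linear, and
    multiplicative up to a twist by [s], without case distinctions. *)
Definition top_coef n f a : Prop := A a /\ polys y A n (f - a * y ^+ n).

Lemma top_coef_polys n f a : top_coef n f a -> polys y A n.+1 f.
Proof.
move=> [Aa Pf]; rewrite -[f](subrK (a * y ^+ n)).
apply: (subspaceD (polysA _)); first exact: polys_mono Pf.
exact: polys_monomial.
Qed.

Lemma polys_top_coef n f : polys y A n.+1 f -> exists a, top_coef n f a.
Proof.
by move=> /polysS[c [a [Pc Aa ->]]]; exists a; split=> //; rewrite addrK.
Qed.

Lemma top_coef_uniq n f a b : top_coef n f a -> top_coef n f b -> a = b.
Proof.
move=> [Aa Pa] [Ab Pb]; apply/subr0_eq/(skew_free AB (n := n)).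
  exact: subspaceB.
have -> : (a - b) * y ^+ n = (f - b * y ^+ n) - (f - a * y ^+ n).
  by rewrite mulrBl opprB [RHS]addrC addrA subrK.
exact: subspaceB.
Qed.

Lemma top_coef_linear n (c : K) f g a b :
  top_coef n f a -> top_coef n g b -> top_coef n (c *: f + g) (c *: a + b).
Proof.
move=> [Aa Pa] [Ab Pb]; split; first by case: sAs => _; apply.
rewrite mulrDl opprD addrACA -scalerAl -scalerBr.
by case: (polysA n) => _; apply.
Qed.

Lemma top_coef_y n m f a : top_coef n f a -> top_coef (n + m) (f * y ^+ m) a.
Proof.
move=> [Aa Pf]; split=> //; rewrite exprD mulrA -mulrBl; exact: polys_y.
Qed.

Lemma top_coef_mul m n f g a b : top_coef m f a -> top_coef n g b ->
  top_coef (m + n) (f * g) (a * iter m s b).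
Proof.
move=> [Aa Pf] [Ab Pg]; split; first by apply/AM/iter_s_A.
have tg : polys y A n.+1 g by apply: top_coef_polys; split; eassumption.
have -> : f * g - a * iter m s b * y ^+ (m + n) =
    (f - a * y ^+ m) * g + (a * (y ^+ m * (g - b * y ^+ n)) +
    a * ((y ^+ m * b - iter m s b * y ^+ m) * y ^+ n)).
  rewrite exprD !(mulrBl, mulrBr, mulrA) [X in _ = _ + X]addrA subrK.
  by rewrite addrA subrK.
apply: (subspaceD (polysA _)); first exact: (@polys_mul A A A).
apply: (subspaceD (polysA _)); apply: (@coef_polys A A) => //; auto.
  exact: y_polys.
exact/polys_y/commy_polys.
Qed.

Lemma top_coef_act n f a g (mu : K) : torus g -> act g y = mu *: y ->
  top_coef n f a -> top_coef n (act g f) (mu ^+ n *: act g a).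
Proof.
move=> tg e [Aa Pf]; split.
  by apply: (subspaceZ _ sAs); apply: (skew_stable AB).
have := polys_act tg Pf.
by rewrite linearB /= rmorphM rmorphXn /= e exprZn -scalerAr -scalerAl.
Qed.

(** * Homogeneous components *)

(** Let theta be Cauchon's homomorphism, for which y theta(a) = s(theta(a)) y. The component with
    top coefficient [a] is theta(a) y^n, and [nu ^+ n] compensates the action of [h] on y^n. [P]
    restricts the top coefficient only. *)
Definition component P n f : Prop :=
  y * f = nu ^+ n *: (s f * y) /\ exists2 a, P a & top_coef n f a.

Lemma subspace_component P n : subspace P -> subspace (component P n).
Proof.
move=> [P0 PL]; split.
  split; first by rewrite linear0 mulr0 mul0r scaler0.
  exists 0 => //; split; first by case: sAs.
  by rewrite mul0r subrr; case: (polysA n).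
move=> c f g [yf [a Pa ta]] [yg [b Pb tb]]; split.
  rewrite mulrDr -scalerAr yf yg linearP mulrDl scalerDr -scalerAl.
  by rewrite !scalerA mulrC.
by exists (c *: a + b); [apply: PL | apply: top_coef_linear].
Qed.

Lemma component_sub P Q n f : P `<=` Q -> component P n f -> component Q n f.
Proof. by move=> PQ [yf [a Pa ta]]; split=> //; exists a => //; apply: PQ. Qed.

Lemma component_polys P n f : component P n f -> polys y A n.+1 f.
Proof. by case=> _ [a _]; apply: top_coef_polys. Qed.

Lemma component_y P n f m : component P n f -> component P (n + m) (f * y ^+ m).
Proof.
move=> [yf [a Pa ta]]; split; last by exists a => //; apply: top_coef_y.
rewrite mulrA yf rmorphM rmorphXn /= (skew_eigenvalue AB) exprZn.
rewrite -!scalerAr -!scalerAl scalerA exprD -mulrA -exprMn.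
rewrite mulVf ?(skew_lambda_neq0 AB) // expr1n mulr1.
by rewrite -!mulrA -exprS exprSr.
Qed.

Lemma component_act P n f g : subspace P -> torus_stable act P -> torus g ->
  component P n f -> component P n (act g f).
Proof.
move=> sP stP tg [yf [a Pa ta]].
have [mu mu0 e] := torus_eigenvalue act_torus (skew_eigen AB) tg; split;
  last first.
  exists (mu ^+ n *: act g a); last exact: top_coef_act.
  by apply: (subspaceZ _ sP); apply: stP.
apply: (scalerI mu0); rewrite scalerAl -e -rmorphM yf.
rewrite [LHS]linearZ /= rmorphM /= e.
by rewrite -scalerAr actC // !scalerA mulrC.
Qed.

Lemma component_mul P Q X m n f g : torus_stable act Q ->
    (forall p q, P p -> Q q -> X (p * q)) ->
  component P m f -> component Q n g -> component X (m + n) (f * g).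
Proof.
move=> stQ PQX [yf [a Pa ta]] [yg [b Qb tb]]; split.
  rewrite mulrA yf -scalerAl -mulrA yg -scalerAr scalerA -exprD.
  by rewrite mulrA rmorphM.
exists (a * iter m s b); last exact: top_coef_mul.
by apply: PQX => //; apply: iter_s_stable.
Qed.

(** Powers of [y] pass through a component at the cost of a scalar and of [si]; this takes the place
    of an Ore condition for the powers of [y]. *)
Lemma component_commy P n f m : component P n f ->
  f * y ^+ m = y ^+ m * (lambda ^+ (n * m) *: iter m si f).
Proof.
have comm1 f' : y * f' = nu ^+ n *: (s f' * y) ->
    s f' * y = lambda ^+ n *: (y * f').
  move=> ->; rewrite scalerA -exprMn divff ?(skew_lambda_neq0 AB) //.
  by rewrite expr1n scale1r.
move=> [yf _]; elim: m f yf => [|m IH] f yf.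
  by rewrite muln0 scale1r mulr1 mul1r.
have yf' : y * si f = nu ^+ n *: (s (si f) * y).
  have := congr1 si yf; rewrite linearZ !rmorphM /= si_y (actK act_torus th).
  rewrite -scalerAl -scalerAr !scalerA [_ * nu]mulrC -scalerA.
  move/(scalerI nu_neq0) => ->; by rewrite (actVK act_torus th).
have := comm1 _ yf'; rewrite (actVK act_torus th) => fy.
rewrite exprS mulrA fy -scalerAl -[y * si f * _]mulrA (IH _ yf') iterSr.
by rewrite -!scalerAr !mulrA scalerA -exprD mulnS.
Qed.

(* Comparing top coefficients in degree [N < n] would give
   [nu ^+ (n - N) = 1]. *)
Lemma component_small n f N : (N <= n)%N ->
  y * f = nu ^+ n *: (s f * y) -> polys y A N f -> f = 0.
Proof.
move=> + yf; elim: N => [_ /sums0 //|N IH lt_Nn] /[dup] /polys_top_coef[a ta].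
move=> Pf; apply: IH; first exact: ltnW.
have t1 : top_coef 1 y 1.
  by split=> //; rewrite mul1r expr1 subrr; case: (polysA 1).
have := top_coef_mul t1 ta; rewrite mul1r add1n => t2.
have := top_coef_act th (skew_eigenvalue AB) ta => /(top_coef_y 1).
rewrite addn1 expr1 => t3.
have t0 : top_coef N.+1 0 0.
  by split; [case: sAs | rewrite mul0r subrr; case: (polysA N.+1)].
have := top_coef_linear (nu ^+ n) t3 t0.
rewrite !addr0 -yf => /(top_coef_uniq t2)/=; rewrite scalerA => e.
have a0 : a = 0.
  apply: (can_inj (actK act_torus th)); rewrite linear0.
  have /eqP := e; rewrite -subr_eq0 -[X in X - _]scale1r -scalerBl scaler_eq0.
  case/orP => [|/eqP //]; rewrite subr_eq0 -(subnK (ltnW lt_Nn)) exprD -mulrA.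
  rewrite -exprMn mulVf ?(skew_lambda_neq0 AB) // expr1n mulr1 eq_sym.
  by rewrite (negbTE (nu_root _)) // subn_gt0.
by case: ta => _; rewrite a0 mul0r subr0.
Qed.

(** The difference satisfies the relation of degree [n] but has degree less than [n]. *)
Lemma component_uniq P Q n f g a : component P n f -> component Q n g ->
  top_coef n f a -> top_coef n g a -> f = g.
Proof.
move=> [yf _] [yg _] tf tg; apply/subr0_eq/(@component_small n _ n) => //.
  by rewrite mulrBr yf yg linearB mulrBl scalerBr.
have [_] := top_coef_linear (-1) tg tf.
by rewrite !scaleN1r addNr mul0r subr0 addrC.
Qed.

Definition lower (a : R) : R := si (d a).

(** The step from [n] to [n.+1] in the commutation of [lift] with [y] forces c_n + c_(n+1) =
    nu^(n+1) c_(n+1), which is this recursion. The denominators are nonzero because [nu] is not a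
    root of unity. *)
Fixpoint lift_coef (n : nat) : K :=
  if n is m.+1 then lift_coef m / (nu ^+ n - 1) else 1.

(* Clearing denominators in Cauchon's deleting-derivation homomorphism:
   [lift n a] is the image of [a] times [y ^+ n]. *)
Definition lift n a : R :=
  \sum_(k < n.+1) lift_coef k *: (iter k lower a * y ^+ (n - k)).

Lemma lift0 a : lift 0 a = a.
Proof. by rewrite /lift big_ord1 /= scale1r mulr1. Qed.

Lemma liftS n a :
  lift n.+1 a = lift n a * y + lift_coef n.+1 *: iter n.+1 lower a.
Proof.
rewrite /lift big_ord_recr /= subnn mulr1; congr (_ + _).
rewrite mulr_suml; apply: eq_bigr => k _.
by rewrite -scalerAl -mulrA -exprSr subSn // -ltnS.
Qed.

(** The defining relation of a component fails by a single term, which disappears once [n.+1]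
    iterations of [lower] kill [a]. *)
Lemma y_lift n a : y * lift n a =
  nu ^+ n *: (s (lift n a) * y) + lift_coef n *: s (iter n.+1 lower a).
Proof.
have s_lower b : s (lower b) = d b by rewrite /lower (actVK act_torus th).
elim: n => [|n IH]; first by rewrite lift0 !scale1r /= s_lower mulyE.
have sv : s (iter n.+2 lower a) = d (iter n.+1 lower a) := s_lower _.
rewrite sv liftS; move: (iter n.+1 lower a) (lift n a) IH => v L IH.
have -> : s (L * y + lift_coef n.+1 *: v) =
    lambda *: (s L * y) + lift_coef n.+1 *: s v.
  by rewrite linearD linearZ rmorphM /= (skew_eigenvalue AB) scalerAr.
have e : lift_coef n + lift_coef n.+1 = nu ^+ n.+1 * lift_coef n.+1.
  have nz : nu ^+ n.+1 - 1 != 0 by rewrite subr_eq0 nu_root.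
  have <- : lift_coef n.+1 * (nu ^+ n.+1 - 1) = lift_coef n by rewrite /= divfK.
  by rewrite mulrBr mulr1 subrK mulrC.
rewrite mulrDr mulrA IH -scalerAr mulyE scalerDr addrA; congr (_ + _).
have e2 : nu ^+ n.+1 * lambda = nu ^+ n.
  by rewrite exprSr -mulrA mulVf ?mulr1 ?(skew_lambda_neq0 AB).
by rewrite !mulrDl -!scalerAl scalerDr !scalerA -addrA -scalerDl e e2.
Qed.

Lemma lower_A a : A a -> A (lower a).
Proof. by move=> Aa; apply/Asi/Ad. Qed.

Lemma iter_lower_A n a : A a -> A (iter n lower a).
Proof. by move=> Aa; elim: n => //= n; apply: lower_A. Qed.

(** [d] and [si] commute up to a scalar, so the n-th iterate of [lower] is a scalar multiple of si^n
    d^n. *)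
Lemma iter_lower_nilpotent a : A a ->
  exists m, forall n, (m <= n)%N -> iter n lower a = 0.
Proof.
have siE n : exists c : K, iter n lower a = c *: iter n si (iter n d a).
  elim: n => [|n [c IH]]; first by exists 1; rewrite scale1r.
  have d_si b k : d (iter k si b) = lambda ^+ k *: iter k si (d b).
    elim: k => [|k IHk] /=; first by rewrite scale1r.
    by rewrite skew_der_si IHk linearZ scalerA -exprS.
  exists (c * lambda ^+ n).
  by rewrite /= IH /lower skew_derZ d_si !linearZ /= scalerA.
move=> /(skew_der_nilpotent AB)[m dm]; exists m => n le_mn.
have [c ->] := siE n; rewrite -(subnK le_mn) [X in iter _ si X]iterD dm.
rewrite iter_skew_der0; elim: (_ + _)%N => [|k IH]; first by rewrite scaler0.
by rewrite /= -[c *: _]linearZ /= IH linear0.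
Qed.

Lemma top_coef_lift n a : A a -> top_coef n (lift n a) a.
Proof.
move=> Aa; split=> //; elim: n => [|n IH].
  by rewrite lift0 mulr1 subrr; case: (polysA 0).
rewrite liftS exprSr mulrA addrAC -mulrBl.
apply: (subspaceD (polysA _)).
  by have := polys_y 1 sAs IH; rewrite addn1 expr1.
apply: (subspaceZ _ (polysA _)).
by apply: polys_coef => //; apply: iter_lower_A.
Qed.

Lemma component_lift P n a : A a -> P a -> iter n.+1 lower a = 0 ->
  component P n (lift n a).
Proof.
move=> Aa Pa a0; split; first by rewrite y_lift a0 linear0 scaler0 addr0.
by exists a => //; apply: top_coef_lift.
Qed.

(** Solving the definition of [lift n a] for its top monomial leaves monomials whose degree has
    dropped by the number of times [lower] was applied, so they inherit the nilpotency
    hypothesis. *)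
Lemma component_decomposition_monomial n a : A a -> iter n.+1 lower a = 0 ->
  sums (component A) n.+1 (a * y ^+ n).
Proof.
have sCA i : subspace (component A i) by exact: subspace_component.
elim/ltn_ind: n a => n IH a Aa a0.
have -> : a * y ^+ n = lift n a -
    \sum_(k < n) lift_coef k.+1 *: (iter k.+1 lower a * y ^+ (n - k.+1)).
  by rewrite /lift big_ord_recl /= scale1r subn0 addrK.
apply: subspaceB; first exact: subspace_sums.
  exact: (sums_mem sCA (ltnSn n)) (component_lift _ _ _).
apply: subspace_sum => [|k _]; first exact: subspace_sums.
apply: (subspaceZ _ (subspace_sums sCA _)).
apply: (@sums_mono _ _ _ sCA (n - k.+1).+1); first by rewrite ltnS leq_subr.
apply: IH; first by rewrite ltn_subrL (leq_ltn_trans _ (ltn_ord k)).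
  exact: iter_lower_A.
rewrite -iterD addSn subnK //; exact: a0.
Qed.

(** A high power of [y] raises the degree of each monomial beyond the nilpotency index of its
    coefficient. *)
Lemma component_decomposition n b : polys y A n b ->
  exists m0, forall m, (m0 <= m)%N -> sums (component A) (n + m) (b * y ^+ m).
Proof.
have sCA i : subspace (component A i) by exact: subspace_component.
elim: n b => [|n IH] b.
  move=> /sums0 ->; exists 0%N => m _; rewrite mul0r.
  by case: (subspace_sums sCA m).
move=> /polysS[c [a [/IH[m1 Hc] Aa ->]]].
have [m2 Ha] := iter_lower_nilpotent Aa; exists (maxn m1 m2) => m.
rewrite geq_max => /andP[le1 le2]; rewrite mulrDl.
apply: (subspaceD (subspace_sums sCA _)).
  exact: (sums_mono sCA _ (Hc m le1)).
rewrite -mulrA -exprD addSn; apply: component_decomposition_monomial => //.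
by apply: Ha; rewrite (leq_trans le2) // leqW ?leq_addl.
Qed.

(** Passage from the exact degree of [lead_coef] to a formal degree. The value 0 is represented by
    the zero polynomial, whence the hypothesis [I 0]. *)
Lemma leading_coefsP (I : set R) a : I 0 ->
  leading_coefs A y I a <-> exists n f, I f /\ top_coef n f a.
Proof.
move=> I0; split.
  move=> [p [Ap Ip ->]]; exists (size p).-1, p.[y]; split=> //.
  split; first by rewrite lead_coefE; apply: Ap.
  case: (eqVneq p 0) => [->|p0].
    by rewrite horner0 lead_coef0 mul0r subrr;
      case: (polysA (size (0 : {poly R})).-1).
  have -> : p.[y] = \sum_(i < (size p).-1.+1) p`_i * y ^+ i.
    by rewrite prednK ?size_poly_gt0 // horner_coef.
  rewrite lead_coefE big_ord_recr /= addrK;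
    exists (fun i => p`_i * y ^+ i) => // i.
  by exists p`_i.
move=> [n [f [If [Aa [g Ag eg]]]]].
have [e|a0] := eqVneq a 0.
  exists 0; rewrite horner0 lead_coef0 e; split=> // i.
  by rewrite coef0; case: sAs.
have [c Hc] := choice (fun i => let: ex_intro2 b Ab eb := Ag i in
  ex_intro (fun b => A b /\ g i = b * y ^+ i) b (conj Ab eb)).
pose E i := if i == n then a else c i.
exists (\poly_(i < n.+1) E i); split.
- move=> i; rewrite coef_poly; case: ifP => _; last by case: sAs.
  by rewrite /E; case: eqP => // _; case: (Hc i).
- rewrite horner_poly big_ord_recr /= {2}/E eqxx.
  rewrite (eq_bigr (fun i : 'I_n => g i)).
    by rewrite -eg subrK.
  by move=> i _; rewrite /E ltn_eqF //; case: (Hc i).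
- by rewrite lead_coef_poly //= /E eqxx.
Qed.

Lemma subspace_sums_component P n : subspace P ->
  subspace (sums (component P) n).
Proof. by move=> sP; apply: subspace_sums => i; apply: subspace_component. Qed.

Lemma sums_commy P n m b : subspace P -> torus_stable act P ->
  sums (component P) n b ->
  exists c, sums (component P) n c /\ b * y ^+ m = y ^+ m * c.
Proof.
move=> sP stP [f Cf ->].
exists (\sum_(i < n) lambda ^+ (i * m) *: iter m si (f i)); split; last first.
  rewrite mulr_suml mulr_sumr; apply: eq_bigr => i _.
  exact: component_commy (Cf i).
exists (fun i => lambda ^+ (i * m) *: iter m si (f i)) => // i.
apply: (subspaceZ _ (subspace_component _ sP)).
elim: m => [//|m IH]; apply: component_act => //.
exact: torus_invP.
Qed.

(** * Ideals stable under division by [y] *)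

Definition saturated (I : set R) : Prop := forall b, B b -> I (b * y) -> I b.

Let By n : B (y ^+ n).
Proof. by apply: (subalgebra_X _ subalgebra_skew); apply: skew_y. Qed.

Lemma component_B P n f : component P n f -> B f.
Proof. by move=> Cf; apply: (@skew_polys_incl n.+1);
  apply: component_polys Cf. Qed.

Section Saturated.
Variable I : set R.
Hypothesis I_ideal : ideal_of B I.
Hypothesis I_stable : torus_stable act I.
Hypothesis I_saturated : saturated I.

Notation lc := (leading_coefs A y I).

Let sI : subspace I := ideal_subspace subalgebra_skew I_ideal.
Let I0 : I 0 := sI.1.
Let IMl a b : B a -> I b -> I (a * b).
Proof. by case: I_ideal => _ _ _ IM Ba Ib; case: (IM a b Ba Ib). Qed.
Let IMr a b : B a -> I b -> I (b * a).
Proof. by case: I_ideal => _ _ _ IM Ba Ib; case: (IM a b Ba Ib). Qed.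

Lemma saturatedX m b : B b -> I (b * y ^+ m) -> I b.
Proof.
move=> Bb; elim: m => [|m IH]; first by rewrite mulr1.
rewrite exprSr mulrA => /I_saturated H; apply: IH; apply: H.
exact: BM.
Qed.

(* Conjugating by [y] and untwisting by [h] multiplies the component of degree
   [i] by [nu ^+ i]; these scalars are pairwise distinct. *)
Lemma ideal_components n f : (forall i, component A i (f i)) ->
  I (\sum_(i < n) f i) -> forall i, (i < n)%N -> I (f i).
Proof.
elim: n f => [//|n IH] f Cf If i.
have If' : I (\sum_(i < n.+1) nu ^+ i *: f i).
  have Csum : B (\sum_(i < n.+1) nu ^+ i *: f i).
    apply: (subspace_sum _ subspace_skew) => j _.
    by apply: (subspaceZ _ subspace_skew); apply: component_B (Cf j).
  have H : I (s (\sum_(i < n.+1) nu ^+ i *: f i) * y).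
    have -> : s (\sum_(i < n.+1) nu ^+ i *: f i) * y = y * \sum_(i < n.+1) f i.
      rewrite linear_sum mulr_suml mulr_sumr; apply: eq_bigr => j _.
      by case: (Cf j) => -> _; rewrite linearZ scalerAl.
    by apply: IMl => //; apply: skew_y.
  move/I_saturated: H => /(_ (skew_torus_stable th Csum)).
  by move=> /(I_stable (torus_invP th)); rewrite (actK act_torus th).
have In : forall i, (i < n)%N -> I (f i).
  move=> j lt_jn.
  have := subspaceB sI If' (subspaceZ (nu ^+ n) sI If).
  rewrite scaler_sumr -sumrB big_ord_recr /= subrr addr0.
  rewrite (eq_bigr (fun i : 'I_n => (nu ^+ i - nu ^+ n) *: f i)); last first.
    by move=> k _; rewrite scalerBl.
  move=> Isum.
  have Cf' k : component A k ((nu ^+ k - nu ^+ n) *: f k).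
    exact: (subspaceZ _ (subspace_component k sAs)).
  have := IH _ Cf' Isum j lt_jn.
  apply: subspaceZ_inv => //; rewrite subr_eq0.
  by apply: contraTneq lt_jn => /nu_inj ->; rewrite ltnn.
rewrite ltnS leq_eqVlt => /orP[/eqP ->|]; last exact: In.
move: If; rewrite big_ord_recr /=; apply: subspace_addl => //.
by apply: subspace_sum => // j _; apply: In.
Qed.

Lemma ideal_component_top n b c :
  sums (component A) n b -> component A n c -> I (b + c) -> I c.
Proof.
move=> [f Cf ->] Cc Ibc.
pose f' i := if i == n then c else f i.
have Cf' i : component A i (f' i) by rewrite /f'; case: eqP => // ->.
have := ideal_components (n := n.+1) Cf' _ (ltnSn n).
rewrite /f' eqxx big_ord_recr /= eqxx; apply.
rewrite (eq_bigr (fun i : 'I_n => f i)) // => i _.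
by rewrite ltn_eqF.
Qed.

(** For the converse, an element of [I] with leading coefficient [a] yields, after multiplication by
    a power of [y], a component in [I] with top coefficient [a]. Brought to a common degree by
    powers of [y], it and [f] coincide, and saturation removes the power. *)
Lemma ideal_components_lc f n a : component A n f -> top_coef n f a ->
  I f <-> lc a.
Proof.
move=> Cf tf; split=> [If|]; first by apply/leading_coefsP => //; exists n, f.
move=> /leading_coefsP - /(_ I0)[k [g [Ig tg]]].
have [m /(_ m (leqnn m))[u Cu eu]] :=
  component_decomposition (top_coef_polys tg).
have tu : top_coef (k + m) (u (k + m)%N) a.
  have [Aa] := top_coef_y m tg; rewrite eu addSn big_ord_recr /= -addrA.
  move=> Pu; split=> //; apply: subspace_addl Pu => //.
  apply: subspace_sum => // i _; apply: (polys_mono sAs (ltn_ord i)).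
  exact: component_polys (Cu i).
have Iu : I (u (k + m)%N).
  apply: (@ideal_components (k.+1 + m) u Cu); last by rewrite addSn.
  by rewrite -eu; apply: IMr.
have : f * y ^+ (k + m) = u (k + m)%N * y ^+ n.
  apply: (component_uniq (component_y (k + m) Cf) (n := (n + (k + m))%N)).
  - rewrite [(n + _)%N]addnC; exact: component_y (Cu _).
  - exact: (top_coef_y (k + m) tf).
  - by rewrite [(n + _)%N]addnC; apply: (top_coef_y n tu).
move=> e; apply: (@saturatedX (k + m)); first exact: component_B Cf.
by rewrite e; apply: IMr.
Qed.

Lemma leading_coefs_sub : lc `<=` A.
Proof. by move=> a /leading_coefsP - /(_ I0)[n [f [_ []]]]. Qed.

Let lift_exists a b : A a -> A b -> exists n f g, [/\ component A n f,
  component A n g, top_coef n f a & top_coef n g b].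
Proof.
move=> Aa Ab; have [k Ha] := iter_lower_nilpotent Aa.
have [l Hb] := iter_lower_nilpotent Ab; exists (k + l)%N.
exists (lift (k + l) a), (lift (k + l) b).
split; try exact: top_coef_lift.
  by apply: component_lift => //; apply: Ha; rewrite leqW // leq_addr.
by apply: component_lift => //; apply: Hb; rewrite leqW // leq_addl.
Qed.

Lemma subspace_leading_coefs : subspace lc.
Proof.
split; first by apply/leading_coefsP => //; exists 0%N, 0; split => //;
  split; [case: sAs | rewrite mul0r subrr; case: (polysA 0)].
move=> c a b la lb.
have [n [f [g [Cf Cg tf tg]]]] := lift_exists (leading_coefs_sub la)
  (leading_coefs_sub lb).
apply/leading_coefsP => //; exists n, (c *: f + g); split.
  by case: sI => _; apply; apply/ideal_components_lc; eassumption.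
exact: top_coef_linear.
Qed.

Lemma leading_coefs_stable : torus_stable act lc.
Proof.
move=> g a tg /leading_coefsP - /(_ I0)[n [f [If tf]]].
have [mu mu0 e] := torus_eigenvalue act_torus (skew_eigen AB) tg.
apply: (subspaceZ_inv subspace_leading_coefs (expf_neq0 n mu0)).
apply/leading_coefsP => //; exists n, (act g f).
by split; [apply: I_stable | apply: top_coef_act].
Qed.

Lemma leading_coefs_ideal : ideal_of A lc.
Proof.
split; [exact: leading_coefs_sub | by case: subspace_leading_coefs | |].
  by move=> a b; apply: subspaceD subspace_leading_coefs.
move=> a b Aa lb.
have key c e : A c -> lc e -> exists n f m g, [/\ I f, component A n f, B g,
    top_coef n f e & top_coef m g c].
  move=> Ac le;
    have [n [f [g [Cf Cg tf tg]]]] := lift_exists (leading_coefs_sub le) Ac.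
  exists n, f, n, g; split => //; last exact: component_B Cg.
  by apply/ideal_components_lc; eassumption.
split.
- have [n0 [_ [g [_ Cg _ tg]]]] := lift_exists Aa Aa.
  (* A left factor of degree [n0] twists the coefficient of the right factor [n0] times by [s]; [b]
     is untwisted beforehand. *)
  have lb' : lc (iter n0 si b) by apply: iter_si_stable => //;
    apply: leading_coefs_stable.
  have [n [f [m [_ [If Cf _ tf _]]]]] := key _ _ Aa lb'.
  apply/leading_coefsP => //; exists (n0 + n)%N, (g * f); split.
    by apply: IMl => //; apply: component_B Cg.
  by have := top_coef_mul tg tf; rewrite iter_siK.
- have [n [f [m [_ [If Cf _ tf _]]]]] := key _ _ Aa lb.
  have Aa' : A (iter n si a) by apply: iter_si_stable => //;
    apply: (skew_stable AB).
  have [_ [_ [m' [g [_ _ Bg _ tg]]]]] := key _ _ Aa' lb.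
  apply/leading_coefsP => //; exists (n + m')%N, (f * g); split;
    first exact: IMr.
  by have := top_coef_mul tf tg; rewrite iter_siK.
Qed.

Lemma lc1 : lc 1 -> I 1.
Proof.
move=> l1; apply/(@ideal_components_lc 1 0 1) => //; last first.
  by split=> //; rewrite mulr1 subrr; case: (polysA 0).
split; last first.
  by exists 1 => //; split=> //; rewrite mulr1 subrr; case: (polysA 0).
by rewrite rmorph1 scale1r mulr1 mul1r.
Qed.

(* Induction on the number of components: the product of the two top ones is
   itself a component of the product. *)
Lemma completely_prime_saturated :
  completely_prime A lc -> completely_prime B I.
Proof.
move=> [l1 lP]; split=> [I1|].
  apply: l1; apply/leading_coefsP => //; exists 0%N, 1; split=> //.
  by split=> //; rewrite mulr1 subrr; case: (polysA 0).
have sC i : subspace (component A i) by exact: subspace_component.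
have primeC m n f g : component A m f -> component A n g ->
    I (f * g) -> I f \/ I g.
  move=> Cf Cg; have [_ [a Aa ta]] := Cf; have [_ [b Ab tb]] := Cg.
  have Cfg : component A (m + n) (f * g).
    by apply: component_mul Cf Cg => //; apply: (skew_stable AB).
  move/(ideal_components_lc Cfg (top_coef_mul ta tb)).
  case/lP => //; first exact: iter_s_A.
    by move=> /(ideal_components_lc Cf ta); left.
  move=> lb; right; apply/(ideal_components_lc Cg tb).
  rewrite -(iter_sK m b); apply: iter_si_stable => //.
  exact: leading_coefs_stable.
have primeS k m n f g : (m + n <= k)%N -> sums (component A) m f ->
    sums (component A) n g -> I (f * g) -> I f \/ I g.
  elim: k m n f g => [|k IH] [|m] [|n] f g // le_k Sf Sg Ifg;
    try by [left; rewrite (sums0 Sf) | right; rewrite (sums0 Sg)].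
  rewrite addSn ltnS in le_k.
  have [f' [fm [Sf' Cf ef]]] := sumsS Sf;
    have [g' [gn [Sg' Cg eg]]] := sumsS Sg.
  have sS k' := @subspace_sums_component A k' sAs.
  have stA := skew_stable AB.
  have : I (fm * gn).
    apply: (@ideal_component_top (m + n) (f' * g + fm * g')).
    - apply: (subspaceD (sS _)).
        apply: (sums_mul sC sC (sS _) _ Sf' Sg) => i j u v lt_i lt_j Cu Cv.
        apply: (sums_mem sC (i := (i + j)%N)); first by rewrite -addSn leq_add.
        exact: component_mul Cu Cv.
      move: g' Sg' {eg}; apply: sums_sub;
        first exact: (subspace_mull fm (sS _)).
      move=> j lt_j v Cv; apply: (sums_mem sC (i := (m + j)%N)).
        by rewrite ltn_add2l.
      exact: component_mul Cf Cv.
    - exact: component_mul Cf Cg.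
    - by rewrite -addrA -mulrDr -eg -mulrDl -ef.
  case/(primeC _ _ _ _ Cf Cg) => Ic.
    have Bg : B g.
      by move: g Sg {Ifg eg}; apply: sums_sub => //;
        [exact: subspace_skew | move=> ? _; apply: component_B].
    case: (IH m n.+1 f' g) => //.
    - by move: Ifg; rewrite ef mulrDl; apply: subspace_addr => //; apply: IMr.
    - by move=> If'; left; rewrite ef; apply: subspaceD.
    - by right.
  have Bf : B f.
    by move: f Sf {Ifg ef}; apply: sums_sub => //;
      [exact: subspace_skew | move=> ? _; apply: component_B].
  case: (IH m.+1 n f g') => //; first by rewrite addSn -addnS.
  - by move: Ifg; rewrite eg mulrDr; apply: subspace_addr => //; apply: IMl.
  - by left.
  - by move=> Ig'; right; rewrite eg; apply: subspaceD.
move=> a b Ba Bb Iab.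
have /(skew_polys AB)[i Pa] := Ba; have /(skew_polys AB)[j Pb] := Bb.
have [m /(_ m (leqnn m)) Sa] := component_decomposition Pa.
have [n /(_ n (leqnn n)) Sb] := component_decomposition Pb.
(* [c] is b y^n after y^m has been moved to its left, so that a b y^n y^m becomes a product of two
   sums of components. *)
have [c [Sc ec]] : exists c, sums (component A) (j + n) c /\
    b * y ^+ n * y ^+ m = y ^+ m * c.
  by apply: sums_commy => //; apply: (skew_stable AB).
have : I (a * y ^+ m * c).
  by rewrite -mulrA -ec !mulrA; apply: IMr => //; apply: IMr.
case/(primeS _ _ _ _ _ (leqnn _) Sa Sc) => [|Ic].
  by move/saturatedX => Ia; left; apply: Ia.
right; apply: (@saturatedX n) => //; apply: (@saturatedX m); first exact: BM.
by rewrite ec; apply: IMl.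
Qed.

End Saturated.

(** * Primeness of the ideal of leading coefficients *)

(** The trace on [B] of the part of B[y^(-1)] whose components have top coefficients in [P]. *)
Definition cone P : set R :=
  [set b | B b /\ exists m n, sums (component P) n (b * y ^+ m)].

Lemma cone_mul P Q X b c : subspace P -> subspace Q -> subspace X ->
    torus_stable act Q -> (forall p q, P p -> Q q -> X (p * q)) ->
  cone P b -> cone Q c -> cone X (b * c).
Proof.
move=> sP sQ sX stQ PQX [Bb [m [i Sb]]] [Bc [n [j Sc]]].
split; first exact: BM.
have [c' [Sc' e]] := sums_commy m sQ stQ Sc.
exists (n + m)%N, (i + j)%N; rewrite exprD -mulrA (mulrA c) e mulrA.
have sC Z k : subspace Z -> subspace (component Z k).
  exact: subspace_component.
apply: (sums_mul _ _ _ _ Sb Sc') => [k|k||k l u v lt_k lt_l Cu Cv]; auto.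
  exact: subspace_sums_component.
apply: (sums_mem _ (i := (k + l)%N)) => [k'||]; auto.
  by rewrite -addSn leq_add // ltnW.
exact: component_mul Cu Cv.
Qed.

Lemma coneA : cone A = B.
Proof.
apply/seteqP; split=> [b []//|b Bb]; split=> //.
have /(skew_polys AB)[n Pb] := Bb.
by have [m /(_ m (leqnn m)) ?] := component_decomposition Pb;
  exists m, (n + m)%N.
Qed.

Lemma subspace_cone P : subspace P -> subspace (cone P).
Proof.
move=> sP; have sS n := @subspace_sums_component P n sP; split.
  split; first by case: subspace_skew.
  by exists 0%N, 0%N; rewrite mul0r; case: (sS 0%N).
move=> c b b' [Bb [m [i Sb]]] [Bb' [m' [i' Sb']]]; split.
  by case: subspace_skew => _ BL; apply: BL.
have up k l f : sums (component P) k f ->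
    sums (component P) (k + l) (f * y ^+ l).
  move: f; apply: sums_sub; first exact: subspace_mulr.
  move=> j lt_j f Cf; apply: (sums_mem _ (i := (j + l)%N)).
  - by move=> ?; apply: subspace_component.
  - by rewrite ltn_add2r.
  - exact: component_y.
exists (m + m')%N, ((i + m') + (i' + m))%N.
have sC k : subspace (component P k) by exact: subspace_component.
have e : b * y ^+ (m + m') = b * y ^+ m * y ^+ m' by rewrite exprD mulrA.
have e' : b' * y ^+ (m + m') = b' * y ^+ m' * y ^+ m.
  by rewrite addnC exprD mulrA.
rewrite mulrDl -scalerAl e e'.
case: (sS ((i + m') + (i' + m))%N) => _ SL; apply: SL.
  by apply: (sums_mono sC _ (up _ m' _ Sb)); apply: leq_addr.
by apply: (sums_mono sC _ (up _ m _ Sb')); apply: leq_addl.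
Qed.

Lemma cone_stable P : subspace P -> torus_stable act P ->
  torus_stable act (cone P).
Proof.
move=> sP stP g b tg [Bb [m [n Sb]]]; split; first exact: skew_torus_stable.
exists m, n; have sS := @subspace_sums_component P n sP.
have [mu mu0 e] := torus_eigenvalue act_torus (skew_eigen AB) tg.
apply: (subspaceZ_inv sS (expf_neq0 m mu0)); rewrite scalerAr -exprZn -e.
rewrite -rmorphXn -rmorphM; move: Sb; apply: (sums_map (f := act g)) => //.
move=> i f lt_in Cf; apply: (sums_mem _ lt_in).
  by move=> ?; apply: subspace_component.
exact: component_act.
Qed.

Lemma cone_ideal P : ideal_of A P -> torus_stable act P -> ideal_of B (cone P).
Proof.
move=> iP stP; have sP := ideal_subspace sA iP; have sC := subspace_cone sP.
split=> [b []//||b b'|a b]; first by case: sC.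
  exact: subspaceD.
have [_ _ _ PM] := iP; have stA := skew_stable AB.
rewrite -coneA => Ca Cb; split.
  by apply: cone_mul Ca Cb => // p q Ap Pq; case: (PM p q).
by apply: cone_mul Cb Ca => // p q Pp Aq; case: (PM q p).
Qed.

(** Ideals of [A] are tested through their cones. If PQ lies in lc(I), the product of the cones lies
    in the cone of lc(I), which saturation puts inside [I]; and if a cone lies in [I], lifting its
    coefficients to components shows that they are in lc(I). *)
Lemma leading_coefs_prime I : H_prime act B I -> saturated I ->
  H_prime act A (leading_coefs A y I).
Proof.
move=> [iI stI I1 IP] satI.
split; [exact: leading_coefs_ideal | exact: leading_coefs_stable | |].
  by move/(lc1 iI stI satI).
move=> P Q iP stP iQ stQ PQ.
have sP := ideal_subspace sA iP; have sQ := ideal_subspace sA iQ.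
have coneI : cone (leading_coefs A y I) `<=` I.
  move=> b [Bb [m [n Sb]]]; apply: (saturatedX satI (m := m)) => //.
  move: Sb; apply: sums_sub; first exact: ideal_subspace subalgebra_skew iI.
  move=> i _ f [yf [a la ta]].
  apply/(ideal_components_lc iI stI satI (n := i) (a := a)) => //.
  by split=> //; exists a => //; apply: (leading_coefs_sub iI la).
have cone_lc X : ideal_of A X -> cone X `<=` I -> X `<=` leading_coefs A y I.
  move=> iX cX a Xa; have [XA _ _ _] := iX; have Aa := XA _ Xa.
  have [n Hn] := iter_lower_nilpotent Aa.
  have Cl := component_lift Aa Xa (Hn _ (leqnSn n)).
  have tl := top_coef_lift n Aa.
  apply/(ideal_components_lc iI stI satI (component_sub XA Cl) tl).
  apply: cX; split; first exact: component_B Cl.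
  exists 0%N, n.+1; rewrite mulr1; apply: (sums_mem _ (ltnSn n)) => // i.
  exact/subspace_component/(ideal_subspace sA iX).
have [] := IP (cone P) (cone Q) (cone_ideal iP stP) (cone_stable sP stP)
  (cone_ideal iQ stQ) (cone_stable sQ stQ).
- move=> b c Cb Cc; apply: coneI; apply: cone_mul Cb Cc => //.
  exact: subspace_leading_coefs.
- by move=> H; left; apply: cone_lc.
- by move=> H; right; apply: cone_lc.
Qed.

(** Hilbert's basis argument. Left multiplication by [y] applies [s] to a top coefficient;
    untwisting by [iter n s] therefore makes [L k n] increase with [n]. *)
Lemma left_noetherian_skew : left_noetherian A -> left_noetherian B.
Proof.
move=> noethA M idM chM.
pose L k n := [set a | A a /\ exists2 b, M k b & top_coef n b (iter n s a)].
have idL k n : left_ideal A (L k n).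
  have [_ sM MM] := idM k; split=> [a []//||a a'].
    split.
      split; first by case: sAs.
      exists 0; first by case: sM.
      rewrite iter_s0; split; first by case: sAs.
      by rewrite mul0r subrr; case: (polysA n).
    move=> c a a' [Aa [b Mb tb]] [Aa' [b' Mb' tb']].
    split; first by case: sAs => _; apply.
    exists (c *: b + b'); first by case: sM => _; apply.
    by rewrite iter_sD iter_sZ; apply: top_coef_linear.
  move=> Aa [Aa' [b Mb tb]]; split; first exact: AM.
  have Asa := iter_s_A n Aa.
  exists (iter n s a * b); first by apply: MM => //; apply: skew_incl.
  rewrite iter_sM -[n in top_coef n]add0n.
  apply: (@top_coef_mul 0 n) => //; split=> //.
  by rewrite mulr1 subrr; case: (polysA 0).
have Lk n k : L k n `<=` L k.+1 n.
  by move=> a [Aa [b Mb tb]]; split=> //; exists b => //; apply: chM.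
have Ln k n : L k n `<=` L k n.+1.
  move=> a [Aa [b Mb tb]]; split=> //; exists (y * b).
    by case: (idM k) => _ _; apply => //; apply: skew_y.
  have t1 : top_coef 1 y 1.
    by split=> //; rewrite mul1r expr1 subrr; case: (polysA 1).
  by have := top_coef_mul t1 tb; rewrite mul1r.
have Lle k k' n n' : (k <= k')%N -> (n <= n')%N -> L k n `<=` L k' n'.
  move=> le_k le_n; apply: (@subset_trans _ (L k' n)).
    exact: (chain_le (M := fun k => L k n)).
  exact: (chain_le (M := L k')).
have [N0 HN0] : exists N0, forall m, (N0 <= m)%N -> L m m `<=` L N0 N0.
  by apply: (noethA (fun k => L k k)) => // k; apply: subset_trans (Ln _ _).
have [N HN] := choice (fun n => noethA (L^~ n) (fun k => idL k n) (Lk n)).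
(* The diagonal chain is stationary from [N0] on, and for each of the finitely many degrees below
   [N0] the chain in [k] is stationary from its own bound. *)
pose M0 := maxn N0 (\max_(n < N0) N n).
have HL k n : (M0 <= k)%N -> L k n `<=` L M0 n.
  move=> le_k; case: (leqP N0 n) => [le_n|lt_n].
    apply: (@subset_trans _ (L (maxn k n) (maxn k n))).
      by apply: Lle; [apply: leq_maxl | apply: leq_maxr].
    apply: subset_trans (HN0 _ _) (Lle _ _ _ _ _ le_n); last exact: leq_maxl.
    by apply: leq_trans le_n _; apply: leq_maxr.
  have leN : (N n <= M0)%N.
    by rewrite leq_max (leq_bigmax (Ordinal lt_n)) orbT.
  by apply: subset_trans (HN _ _ (leq_trans leN le_k)) (Lle _ _ _ _ leN _).
exists M0 => k le_k b Mb; have [MB _ _] := idM k.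
have /(skew_polys AB)[n] := MB b Mb.
elim: n b Mb => [|n IH] b Mb; first by move/sums0 => ->; case: (idM M0) => _ [].
move=> /polys_top_coef[a ta]; have Aa : A a by case: ta.
have : L k n (iter n si a).
  split; last by exists b; rewrite ?iter_siK.
  by apply: iter_si_stable => //; apply: (skew_stable AB).
move/(HL k n le_k) => [_ [b' Mb']]; rewrite iter_siK => tb'.
have [_ sMk _] := idM k; have [_ sM0 _] := idM M0.
have Mkb' : M k b' by apply: chain_le Mb'.
rewrite -[b](subrK b'); apply: subspaceD => //; apply: IH.
  exact: subspaceB.
have [_] := top_coef_linear (-1) tb' ta.
by rewrite !scaleN1r addNr mul0r subr0 addrC.
Qed.

(** * Complete primeness *)

(** The elements c with Pc inside [I] form a two-sided ideal, torus-stable because [P] is; it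
    contains [v], whatever the torus does to [v]. *)
Lemma H_prime_mul C I P v : subalgebra C -> torus_stable act C ->
    H_prime act C I -> ideal_of C P -> torus_stable act P -> C v ->
    (forall p, P p -> I (p * v)) ->
  P `<=` I \/ I v.
Proof.
move=> sC stC [iI stI _ IP] iP stP Cv PvI.
have [[IC I0 ID IM] [PC _ _ PM]] := (iI, iP).
pose Q := [set c | C c /\ forall p, P p -> I (p * c)].
have iQ : ideal_of C Q.
  split=> [c []//|||].
  - split=> [|p _]; first by case: (subalgebra_subspace sC).
    by rewrite mulr0.
  - move=> a b [Ca Ha] [Cb Hb]; split;
    first exact: (subspaceD (subalgebra_subspace sC)).
    by move=> p Pp; rewrite mulrDr; apply: ID; auto.
  - have [_ _ CM] := sC; move=> a b Ca [Cb Hb]; split; split; auto => p Pp.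
      by rewrite mulrA; apply: Hb; case: (PM _ _ Ca Pp).
    by rewrite mulrA; case: (IM _ _ Ca (Hb p Pp)).
have stQ : torus_stable act Q.
  move=> g c tg [Cc Hc]; split; first exact: stC.
  move=> p Pp; rewrite -(actVK act_torus tg p) -rmorphM; apply: stI => //.
  by apply: Hc; apply: stP => //; apply: torus_invP.
have [] := IP P Q iP stP iQ stQ; [by move=> p q Pp [_]; apply | by left |].
by move=> QI; right; apply: QI.
Qed.

(** The elements c with c C v inside [I] form an ideal, torus-stable because [v] is an eigenvector;
    it contains [u] and multiplies [v] into [I]. *)
Lemma H_prime_eigenvectors C I u v : subalgebra C -> torus_stable act C ->
    H_prime act C I -> C u -> C v ->
    (forall g, torus g -> exists mu : K, act g v = mu *: v) ->
    (forall b, C b -> I (u * b * v)) ->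
  I u \/ I v.
Proof.
move=> sC stC I_pr Cu Cv ev uvI; have [iI stI _ _] := I_pr.
have sI := ideal_subspace sC iI.
pose P := [set c | C c /\ forall b, C b -> I (c * b * v)].
have [_ _ CM] := sC; have [_ _ _ IM] := iI.
have iP : ideal_of C P.
  split=> [c []//|||].
  - split=> [|b _]; first by case: (subalgebra_subspace sC).
    by rewrite !mul0r; case: sI.
  - move=> a b [Ca Ha] [Cb Hb]; split;
    first exact: (subspaceD (subalgebra_subspace sC)).
    by move=> c Cc; rewrite !mulrDl; apply: subspaceD; auto.
  - move=> a b Ca [Cb Hb]; split; split; auto => c Cc.
      by rewrite -!mulrA; apply: (IM _ _ Ca _).1; rewrite mulrA; apply: Hb.
    by rewrite -(mulrA b); apply: Hb; apply: CM.
have stP : torus_stable act P.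
  move=> g c tg [Cc Hc]; split; first exact: stC.
  move=> b Cb; have tg' := torus_invP tg; have [mu e] := ev _ tg'.
  rewrite -(actVK act_torus tg b) -(actVK act_torus tg v) -!rmorphM e.
  by apply: stI => //; rewrite -scalerAr; apply: (subspaceZ _ sI); apply: Hc;
    apply: stC.
have [] := H_prime_mul sC stC I_pr iP stP Cv.
- by move=> p [_ Hp]; rewrite -[p]mulr1; apply: Hp; case: sC.
- by move=> PI; left; apply: PI.
- by right.
Qed.

(** * Gaussian binomials at [nu], the q-Leibniz rule and cores *)

Fixpoint qbin (n k : nat) : K :=
  match n, k with
  | _, 0 => 1
  | 0, _.+1 => 0
  | n'.+1, k'.+1 => qbin n' k' + nu ^+ k'.+1 * qbin n' k'.+1
  end.

Lemma qbin0 n : qbin n 0 = 1. Proof. by case: n. Qed.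

Lemma qbin_small n k : (n < k)%N -> qbin n k = 0.
Proof.
elim: n k => [|n IH] [|k] // lt_nk; rewrite /= !IH ?mulr0 ?addr0 //.
exact: ltnW.
Qed.

Lemma qbinnn n : qbin n n = 1.
Proof. by elim: n => //= n ->; rewrite qbin_small // mulr0 addr0. Qed.

(** Let (q)_k be the product of the 1 - nu^i for 1 <= i <= k. The binomial times (q)_m (q)_n equals
    (q)_(m+n), which is nonzero. *)
Lemma qbin_neq0 m n : qbin (m + n) m != 0.
Proof.
pose qp k := \prod_(i < k) (1 - nu ^+ i.+1).
have qpS k : qp k.+1 = qp k * (1 - nu ^+ k.+1) by rewrite /qp big_ord_recr.
have qp_neq0 k : qp k != 0.
  by apply/prodf_neq0 => i _; rewrite subr_eq0 eq_sym nu_root.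
have H k : forall m n, (m + n)%N = k ->
    qbin (m + n) m * (qp m * qp n) = qp (m + n)%N.
  elim: k => [|k IH] {m n} [|m] [|n] //.
  - by rewrite /qp !big_ord0 !mulr1.
  - by rewrite qbin0 /qp !big_ord0 !mul1r.
  - by rewrite addn0 qbinnn mul1r /qp big_ord0 mulr1.
  rewrite addSn => -[e]; have IH1 := IH m n.+1 e.
  have IH2 := IH m.+1 n; rewrite addSnnS in IH2; have {}IH2 := IH2 e.
  rewrite /= [qp (m + n.+1).+1]qpS.
  have -> : nu ^+ (m + n.+1).+1 = nu ^+ m.+1 * nu ^+ n.+1.
    by rewrite -exprD addSn.
  rewrite mulrDl (_ : 1 - _ = (1 - nu ^+ m.+1) + nu ^+ m.+1 * (1 - nu ^+ n.+1)).
    rewrite mulrDr -{1}IH1 -IH2 !qpS; congr (_ + _); ring.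
  ring.
have /eqP := H _ m n erefl; apply: contraTneq => ->.
by rewrite mul0r eq_sym qp_neq0.
Qed.

(** Pascal's recursion for [qbin] collects the two terms produced by each [d]; the factor [nu ^+ i]
    is the cost of moving [d] past the i-th power of [s]. *)
Lemma iter_skew_derM n a b : iter n d (a * b) =
  \sum_(k < n.+1) qbin n k *: (iter k s (iter (n - k) d a) * iter k d b).
Proof.
elim: n => [|n IH]; first by rewrite big_ord1 scale1r.
pose U k := iter k s (iter (n.+1 - k) d a) * iter k d b.
have dsum (I : finType) (f : I -> R) : d (\sum_i f i) = \sum_i d (f i).
  by apply: (big_morph d skew_derD skew_der0).
rewrite iterS IH dsum.
have -> : \sum_(i < n.+1)
      d (qbin n i *: (iter i s (iter (n - i) d a) * iter i d b)) =
    \sum_(i < n.+1) qbin n i *: U i.+1 +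
      \sum_(i < n.+2) (nu ^+ i * qbin n i) *: U i.
  rewrite [X in _ = _ + X]big_ord_recr /= qbin_small // mulr0 scale0r addr0.
  rewrite -big_split.
  apply: eq_bigr => i _; rewrite skew_derZ skew_derM iter_s_der /U subSS -iterS.
  have le_in : (i <= n)%N by rewrite -ltnS.
  rewrite (subSn le_in) scalerDr /= -scalerAl scalerA.
  by rewrite [qbin _ _ * _]mulrC.
rewrite [X in _ + X]big_ord_recl [RHS]big_ord_recl addrCA /= mul1r qbin0.
congr (_ + _); rewrite -big_split; apply: eq_bigr => i _.
by rewrite /= -scalerDl.
Qed.

Definition der_core (X : set R) : set R :=
  [set a | A a /\ forall n, X (iter n d a)].

Lemma iter_der_A n a : A a -> A (iter n d a).
Proof. by move=> Aa; elim: n => //= n; apply: Ad. Qed.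

Lemma der_core_sub X : der_core X `<=` X.
Proof. by move=> a [_ /(_ 0%N)]. Qed.

Lemma der_core_der X a : der_core X a -> der_core X (d a).
Proof.
by move=> [Aa Xa]; split; [apply: Ad | move=> n; rewrite -iterSr].
Qed.

Lemma der_core_mul P Q X a b : torus_stable act P -> subspace X ->
    (forall p q, P p -> Q q -> X (p * q)) ->
  der_core P a -> der_core Q b -> der_core X (a * b).
Proof.
move=> stP sX PQX [Aa Pa] [Ab Qb]; split=> [|n]; first exact: AM.
rewrite iter_skew_derM; apply: subspace_sum => // k _; apply: subspaceZ => //.
by apply: PQX => //; apply: iter_s_stable.
Qed.

Lemma der_core_ideal X : ideal_of A X -> torus_stable act X ->
  ideal_of A (der_core X).
Proof.
move=> iX stX; have sX := ideal_subspace sA iX; have [XA X0 XD XM] := iX.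
have coreA a : A a -> der_core A a by move=> Aa; split=> // n;
  apply: iter_der_A.
split=> [a []//||a b [Aa Xa] [Ab Xb]|a b Aa Xb].
- by split=> [|n]; [case: sAs | rewrite iter_skew_der0].
- split=> [|n]; first exact: subspaceD.
  by rewrite -[a]scale1r iter_skew_der_linear scale1r; apply: XD.
- split.
    apply: der_core_mul Xb => //; [exact: (skew_stable AB) | | exact: coreA].
    by move=> p q Ap Xq; case: (XM p q).
  apply: (der_core_mul _ _ _ Xb (coreA _ Aa)) => // p q Xp Aq.
  by case: (XM q p).
Qed.

Lemma der_core_stable X : subspace X -> torus_stable act X ->
  torus_stable act (der_core X).
Proof.
move=> sX stX g a tg [Aa Xa]; split; first exact: (skew_stable AB).
move=> n; have [mu _ ->] := iter_skew_der_act n a tg.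
by apply: subspaceZ => //; apply: stX.
Qed.

Lemma last_nonmember (X : set R) a :
    X 0 -> A a -> ~ (forall n, X (iter n d a)) ->
  exists2 i, ~ X (iter i d a) & forall k, (i < k)%N -> X (iter k d a).
Proof.
move=> X0 Aa /existsNP[n0 Xn0]; have [N dN] := skew_der_nilpotent AB Aa.
have ex : exists n, `[< ~ X (iter n d a) >] by exists n0; apply/asboolP.
have ub n : `[< ~ X (iter n d a) >] -> (n <= N)%N.
  move/asboolP => Xn; rewrite leqNgt; apply/negP => lt_Nn; apply: Xn.
  by rewrite -(subnK (ltnW lt_Nn)) iterD dN iter_skew_der0.
case: (ex_maxnP ex ub) => i /asboolP Xi maxi; exists i => // k lt_ik.
apply: contrapT => Xk; have := maxi k; rewrite leqNgt lt_ik.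
by move=> H; have := H (introT (asboolP _) Xk).
Qed.

(* Let [i] and [j] be the last orders at which the derivatives of [a] and [b]
   are outside [X]; then exactly one term of the q-Leibniz expansion of the
   derivative of order [i + j] of [a * b] is outside [X]. *)
Lemma der_core_completely_prime X : ideal_of A X -> torus_stable act X ->
  completely_prime A X -> completely_prime A (der_core X).
Proof.
move=> iX stX [X1 XP]; have sX := ideal_subspace sA iX; have [_ X0 _ XM] := iX.
split; first by move=> /der_core_sub.
move=> a b Aa Ab [_ Xab].
case: (pselect (forall n, X (iter n d a))) => [|na]; first by left.
case: (pselect (forall n, X (iter n d b))) => [|nb]; first by right.
have [i ni Hi] := last_nonmember X0 Aa na;
  have [j nj Hj] := last_nonmember X0 Ab nb.
exfalso; have := Xab (j + i)%N; rewrite iter_skew_derM.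
have lt_j : (j < (j + i).+1)%N by rewrite ltnS leq_addr.
rewrite (bigD1 (Ordinal lt_j)) //= => Hsum.
have H : X (qbin (j + i) j *: (iter j s (iter (j + i - j) d a) * iter j d b)).
  apply: subspace_addr Hsum => //; apply: subspace_sum => // k.
  rewrite -val_eqE /= => kj.
  apply: subspaceZ => //.
  have Aka : A (iter k s (iter (j + i - k) d a)) by apply/iter_s_A/iter_der_A.
  have Akb := iter_der_A k Ab.
  case: (ltngtP k j) kj => // lt_kj _.
    apply: (XM _ _ Akb _).2; apply: iter_s_stable => //; apply: Hi.
    by rewrite ltn_subRL ltn_add2r.
  by apply: (XM _ _ Aka _).1; apply: Hj.
have {H} := subspaceZ_inv sX (qbin_neq0 j i) H.
rewrite addKn; case/XP => //; [exact/iter_s_A/iter_der_A | exact: iter_der_A |].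
by move=> H; apply: ni; rewrite -(iter_sK j (iter i d a));
  apply: iter_si_stable.
Qed.

(** * Extension and contraction of ideals *)

Definition extension P : set R := [set b | exists n, polys y P n b].

Lemma extension_incl P a : subspace P -> P a -> extension P a.
Proof. by move=> sP Pa; exists 1%N; apply: polys_coef. Qed.

Lemma extension_mul P Q X a b : subspace Q -> subspace X ->
    (forall q, Q q -> Q (s q)) -> (forall q, Q q -> Q (d q)) ->
    (forall p q, P p -> Q q -> X (p * q)) ->
  extension P a -> extension Q b -> extension X (a * b).
Proof.
move=> sQ sX Qs Qd PQX [m Pa] [n Qb]; exists (m + n)%N.
by apply: (@polys_mul P Q X) => //; apply: polys_mono Qb.
Qed.

Lemma extension_ideal P : ideal_of A P -> torus_stable act P ->
  (forall p, P p -> P (d p)) -> ideal_of B (extension P).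
Proof.
move=> iP stP Pd; have sP := ideal_subspace sA iP; have [PA P0 PD PM] := iP.
have extA b : B b -> extension A b by move/(skew_polys AB).
split=> [b [n Pb]|||a b Ba Pb].
- by apply: (@skew_polys_incl n); apply: polys_sub Pb.
- exact: (extension_incl sP P0).
- move=> a b [m Pa] [n Pb]; exists (maxn m n);
  apply: (subspaceD (subspace_polys _ sP)).
    by apply: polys_mono Pa; rewrite ?leq_maxl.
  by apply: polys_mono Pb; rewrite ?leq_maxr.
- split.
    apply: (extension_mul _ _ _ _ _ (extA a Ba) Pb) => // [q|p q Ap Pq].
      exact: stP.
    by case: (PM p q).
  apply: (extension_mul _ _ _ _ _ Pb (extA a Ba)) => // p q Pp Aq.
  by case: (PM q p).
Qed.

Lemma extension_stable P : subspace P -> torus_stable act P ->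
  torus_stable act (extension P).
Proof.
move=> sP stP g b tg [n Pb]; exists n; move: b Pb.
apply: (@polys_ind P n [set b | polys y P n (act g b)]).
  exact/subspace_preim/subspace_polys.
have [mu _ e] := torus_eigenvalue act_torus (skew_eigen AB) tg.
move=> i a lt_in Pa /=; rewrite rmorphM rmorphXn /= e exprZn -scalerAr.
apply: (subspaceZ _ (subspace_polys _ sP)); apply: polys_monomial => //.
exact: stP.
Qed.

Lemma extension_sub P I : ideal_of B I -> P `<=` I -> extension P `<=` I.
Proof.
move=> iI PI b [n Pb]; have [_ _ _ IM] := iI; move: Pb; apply: polys_ind.
  exact: ideal_subspace subalgebra_skew iI.
by move=> i a _ /PI Ia; apply: (IM _ _ (By i) Ia).2.
Qed.

Lemma contraction_ideal I : ideal_of B I -> ideal_of A (I `&` A).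
Proof.
move=> [IB I0 ID IM]; split=> [a []//|||a b Aa [Ib Ab]].
- by split=> //; case: sAs.
- by move=> a b [Ia Aa] [Ib Ab]; split; [apply: ID | apply: subspaceD].
- have [I1 I2] := IM _ _ (skew_incl Aa) Ib.
  by split; split => //; apply: AM.
Qed.

Lemma contraction_stable I : torus_stable act I -> torus_stable act (I `&` A).
Proof.
by move=> stI g a tg [Ia Aa]; split; [apply: stI | apply: (skew_stable AB)].
Qed.

Lemma contraction_der I a : ideal_of B I -> torus_stable act I ->
  (I `&` A) a -> (I `&` A) (d a).
Proof.
move=> iI stI [Ia Aa]; split; last exact: Ad.
have [_ _ _ IM] := iI; apply: (subspaceB (ideal_subspace subalgebra_skew iI)).
  exact: (IM _ _ skew_y Ia).1.
by apply: (IM _ _ skew_y _).2; apply: stI.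
Qed.

Section Contraction.
Variable I : set R.
Hypothesis I_prime : H_prime act B I.

Notation I0 := (I `&` A).

Let iI : ideal_of B I. Proof. by case: I_prime. Qed.
Let stI : torus_stable act I. Proof. by case: I_prime. Qed.
Let sI : subspace I := ideal_subspace subalgebra_skew iI.
Let iI0 : ideal_of A I0 := contraction_ideal iI.
Let stI0 : torus_stable act I0 := contraction_stable stI.

(** As [I0] is [d]-stable, the last two conditions say that [der_core X] equals [I0]. *)
Let core_good (X : set R) : Prop :=
  [/\ ideal_of A X, torus_stable act X, I0 `<=` X & der_core X `<=` I0].

Lemma maximal_core : exists X, core_good X /\
  forall Z, core_good Z -> X `<=` Z -> Z `<=` X.
Proof.
have good0 : core_good I0 by split=> // a [_ /(_ 0%N)].
(* Zorn's lemma also asks for the union of the empty chain to be good; adjoining [I0] to each member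
   takes care of it. *)
have [F FP totF|Y [goodY maxY]] :=
    @Zorn_bigcup _ [set Y | core_good (I0 `|` Y)].
  pose G Z := Z = I0 \/ exists2 Y, F Y & Z = I0 `|` Y.
  have Ggood Z : G Z -> core_good Z by move=> [->//|[Y FY ->]]; apply: FP.
  have Gtot Z Z' : G Z -> G Z' -> Z `<=` Z' \/ Z' `<=` Z.
    move=> [->|[Y FY ->]] [->|[Y' FY' ->]];
      [by left|by left; left|by right; left|].
    have [le|le] := totF _ _ FY FY'; [left | right]; exact: setUS.
  have GX Z : G Z -> Z `<=` I0 `|` \bigcup_(Y in F) Y.
    by move=> [->|[Y FY ->]] a; [left | case; [left | right; exists Y]].
  have XG a : (I0 `|` \bigcup_(Y in F) Y) a -> exists2 Z, G Z & Z a.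
    move=> [Ia|[Y FY Ya]]; first by exists I0; [left |].
    by exists (I0 `|` Y); [right; exists Y | right].
  have XG2 Z a : G Z -> (I0 `|` \bigcup_(Y in F) Y) a ->
      exists Z', [/\ G Z', Z `<=` Z' & Z' a].
    move=> GZ /XG[Z' GZ' Za]; have [le|le] := Gtot _ _ GZ GZ'.
      by exists Z'.
    by exists Z; split=> //; apply: le.
  split=> [|||a [Aa Xa]].
  - split=> [a|||a b Aa Xb].
    + by move=> /XG[Z /Ggood[[ZA _ _ _] _ _ _]]; apply: ZA.
    + by left; case: iI0.
    + move=> a b /XG[Z GZ Za] /(XG2 _ _ GZ)[Z' [GZ' le Zb]].
      apply: (GX Z') => //; have [[_ _ ZD _] _ _ _] := Ggood _ GZ'.
      by apply: ZD => //; apply: le.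
    + have [Z GZ Zb] := XG _ Xb; have [[_ _ _ ZM] _ _ _] := Ggood _ GZ.
      by have [? ?] := ZM _ _ Aa Zb; split; apply: (GX Z).
  - move=> g a tg /XG[Z GZ Za]; apply: (GX Z) => //.
    by have [_ st _ _] := Ggood _ GZ; apply: st.
  - by move=> a; left.
  (* By local nilpotency only finitely many derivatives of [a] are nonzero, so a single member of
     the chain contains them all. *)
  have [N dN] := skew_der_nilpotent AB Aa.
  have [Z [GZ HZ]] : exists Z, G Z /\ forall n, (n < N)%N -> Z (iter n d a).
    elim: N {dN} => [|N [Z [GZ HZ]]]; first by exists I0; split=> //; left.
    have [Z' [GZ' le Za]] := XG2 _ _ GZ (Xa N); exists Z'; split=> // n.
    by rewrite ltnS leq_eqVlt => /orP[/eqP->//|/HZ/le].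
  have [[_ Z0 _ _] _ _ ] := Ggood _ GZ; apply; split=> // n.
  case: (ltnP n N) => [/HZ//|le_Nn].
  by rewrite -(subnK le_Nn) iterD dN iter_skew_der0.
exists (I0 `|` Y); split=> // Z goodZ leZ.
have IZ : I0 `|` Z = Z.
  by apply/setUidPr; apply: subset_trans leZ => a; left.
apply: contrapT => nZ; apply: (maxY Z); last by rewrite /= IZ.
split; first by apply: subset_trans leZ => a; right.
by move=> ZY; apply: nZ => a /ZY; right.
Qed.

(** Why a maximal [X] is H-prime: for P and Q not inside [X], the ideals P + X and Q + X have cores
    outside [I0]. If PQ were inside [X], the product of these cores would lie in the core of [X],
    that is in [I0]. Being [d]-stable, the cores extend to ideals of [B] whose product is in [I],
    against primeness of [I]. *)
Lemma contraction_completely_prime :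
    (forall Q, H_prime act A Q -> completely_prime A Q) ->
  completely_prime A I0.
Proof.
move=> CPA; have [X [[iX stX I0X coreX] maxX]] := maximal_core.
have sX := ideal_subspace sA iX; have stA := skew_stable AB.
suff X_prime : H_prime act A X.
  have -> : I0 = der_core X.
    apply/seteqP; split=> // a Ia; split; first by case: Ia.
    move=> n; apply: I0X; elim: n => //= n; exact: contraction_der.
  by apply: der_core_completely_prime => //; apply: CPA.
have I1 : ~ I 1 by case: I_prime.
have extend P : ideal_of A P -> torus_stable act P -> ~ P `<=` X ->
    exists Z, [/\ ideal_of A Z, torus_stable act Z, ~ der_core Z `<=` I0 &
      forall z, Z z -> exists p q, [/\ P p, X q & z = p + q]].
  move=> iP stP nPX; pose Z := [set b | exists p q, [/\ P p, X q & b = p + q]].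
  have iZ : ideal_of A Z by apply: ideal_sum.
  have XZ : X `<=` Z.
    by move=> a Xa; exists 0, a; rewrite add0r; split=> //; case: iP.
  have stZ : torus_stable act Z.
    move=> g _ tg [p [q [Pp Xq ->]]]; exists (act g p), (act g q).
    by rewrite linearD; split; [apply: stP | apply: stX |].
  exists Z; split=> // coreZ; apply: nPX => p Pp; apply: (maxX Z).
  - by split=> //; apply: subset_trans XZ.
  - exact: XZ.
  - by exists p, 0; rewrite addr0; split=> //; case: iX.
split=> //.
  move=> X1; apply: I1; apply: (coreX 1 _).1; split=> // n.
  have [_ _ _ XM] := iX; rewrite -[iter n d 1]mulr1.
  exact: (XM _ _ (iter_der_A n A1) X1).1.
move=> P Q iP stP iQ stQ PQX; apply: contrapT => /not_orP[nP nQ].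
have [U [iU stU nU UP]] := extend P iP stP nP.
have [V [iV stV nV VQ]] := extend Q iQ stQ nQ.
have [[PA _ _ _] [QA _ _ _] [XA _ _ XM]] := And3 iP iQ iX.
have UVX u v : U u -> V v -> X (u * v).
  move=> /UP[p [x [Pp Xx ->]]] /VQ[q [x' [Qq Xx' ->]]].
  have Ax' : A (q + x') by apply: (subspaceD sAs (QA _ Qq)); apply: XA.
  rewrite mulrDl; apply: subspaceD => //; last exact: (XM _ _ Ax' Xx).2.
  rewrite mulrDr; apply: subspaceD => //; first exact: PQX.
  exact: (XM _ _ (PA _ Pp) Xx').1.
have sU := ideal_subspace sA iU; have sV := ideal_subspace sA iV.
have iCU := der_core_ideal iU stU; have iCV := der_core_ideal iV stV.
have stCU := der_core_stable sU stU; have stCV := der_core_stable sV stV.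
have [_ _ _ IP] := I_prime.
have sCU := ideal_subspace sA iCU; have sCV := ideal_subspace sA iCV.
have [] := IP _ _ (extension_ideal iCU stCU (@der_core_der U))
  (extension_stable sCU stCU) (extension_ideal iCV stCV (@der_core_der V))
  (extension_stable sCV stCV).
- move=> p q Up Vq; have I0I : I0 `<=` I by move=> a [].
  apply: (extension_sub iI I0I).
  apply: (extension_mul _ _ _ _ _ Up Vq) => //.
  + exact: ideal_subspace sA iI0.
  + by move=> c; apply: stCV.
  + exact: der_core_der.
  + by move=> u v Cu Cv; apply: coreX; apply: (der_core_mul stU sX UVX).
- move=> UI; apply: nU => a Ca; split; last by case: Ca.
  by apply: UI; apply: extension_incl.
- move=> VI; apply: nV => a Ca; split; last by case: Ca.
  by apply: VI; apply: extension_incl.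
Qed.

(** * The Ore condition and division by [y] *)

(** Noetherian domains are Ore. Modulo [I0], the left ideals generated by the c e^i with i < n
    become stationary, which yields a relation between these elements; it is shortened until its e^0
    term balances a right multiple of [e] whose cofactor is outside [I0]. *)
Lemma left_ore_mod c e : left_noetherian A -> completely_prime A I0 ->
    A c -> ~ I0 c -> A e ->
  exists t w, [/\ A t, A w, ~ I0 t & I0 (t * e - w * c)].
Proof.
move=> noethA [_ I0P] Ac nc Ae; have sI0 := ideal_subspace sA iI0.
have [_ _ _ I0M] := iI0; have AX i : A (e ^+ i) by apply: subalgebra_X.
pose F i := [set m | A m /\ exists2 a, A a & I0 (m - a * c * e ^+ i)].
have sF i : subspace (F i).
  split.
    split; first by case: sAs.
    by exists 0; [case: sAs | rewrite !mul0r subrr; case: sI0].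
  move=> k m m' [Am [a Aa Ia]] [Am' [a' Aa' Ia']].
  split; first by case: sAs => _ H; apply: H.
  exists (k *: a + a'); first by case: sAs => _ H; apply: H.
  rewrite !mulrDl opprD addrACA -!scalerAl -scalerBr.
  by case: sI0 => _ H; apply: H.
have key n x (a : nat -> R) : A x -> ~ I0 x -> (forall i, A (a i)) ->
    I0 (\sum_(i < n) a i * c * e ^+ i + x * c * e ^+ n) ->
    exists t w, [/\ A t, A w, ~ I0 t & I0 (t * e - w * c)].
  move=> Ax nx; elim: n a => [|n IH] a Aa.
    by rewrite big_ord0 add0r mulr1 => /I0P[].
  (* The relation without its e^0 term, divided by [e] on the right. If [t] is in [I0], it is a
     shorter relation with the same top coefficient [x]. *)
  pose t := \sum_(i < n) a i.+1 * c * e ^+ i + x * c * e ^+ n.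
  have At : A t.
    apply: subspaceD => //; last by apply: AM => //; apply: AM.
    by apply: subspace_sum => // i _; apply: AM => //; apply: AM.
  rewrite big_ord_recl mulr1 -addrA => Irel.
  case: (pselect (I0 t)) => [It|nt]; first by apply: (IH (fun i => a i.+1)).
  exists t, (- a 0%N); split=> //; first exact: subspaceN.
  rewrite mulNr opprK addrC; move: Irel; congr (I0 (_ + _)).
  rewrite /t mulrDl mulr_suml -[x * c * e ^+ n * e]mulrA -exprSr; congr (_ + _).
  by apply: eq_bigr => i _; rewrite -[RHS]mulrA -exprSr.
have [||n Hn] := noethA (sums F).
- move=> n; have sS := subspace_sums sF n; split=> //.
    by apply: sums_sub => // i _ m [].
  move=> b m Ab; move: m; apply: sums_sub; first exact: subspace_mull.
  move=> i lt_in m [Am [a Aa Ia]]; apply: (sums_mem sF lt_in).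
  split; first exact: AM.
  exists (b * a); first exact: AM.
  have -> : b * m - b * a * c * e ^+ i = b * (m - a * c * e ^+ i).
    by rewrite mulrBr !mulrA.
  exact: (I0M _ _ Ab Ia).1.
- by move=> k m; apply: sums_mono.
have [f Ff ef] : sums F n (c * e ^+ n).
  apply: (Hn n.+1 (leqnSn n)); apply: (sums_mem sF (ltnSn n)).
  split; first exact: AM.
  by exists 1 => //; rewrite mul1r subrr; case: sI0.
have [a Ha] := choice (fun i => let: conj _ (ex_intro2 a Aa Ia) := Ff i in
  ex_intro (fun a => A a /\ I0 (f i - a * c * e ^+ i)) a (conj Aa Ia)).
apply: (key n (-1) a) => [||i|].
- exact: subspaceN.
- move=> /(subspaceN sI0); rewrite opprK => I1.
  by apply: nc; rewrite -[c]mulr1; apply: (I0M _ _ Ac I1).1.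
- by case: (Ha i).
- rewrite !mulN1r mulNr ef -sumrB.
  apply: subspace_sum => // i _; rewrite -opprB; apply: subspaceN => //.
  by case: (Ha i).
Qed.

(** If [d] maps [A] into [I0], every y b is congruent modulo [I] to some b' y, and primeness applies
    to [y] and its powers. Otherwise some derivative survives modulo [I0], and the descent shows
    that [I] contains no power of [y]. *)
Lemma y_power_prime n : left_noetherian A ->
    (forall Q, H_prime act A Q -> completely_prime A Q) ->
  I (y ^+ n) -> I y.
Proof.
move=> noethA CPA Iyn; have I0_cp := contraction_completely_prime CPA.
have [I1 I0P] := I0_cp; have sI0 := ideal_subspace sA iI0.
have [_ _ _ IM] := iI; have [_ _ _ I0M] := iI0.
have IMl a b : B a -> I b -> I (a * b) by move=> Ba Ib; case: (IM a b).
have IMr a b : B a -> I b -> I (b * a) by move=> Ba Ib; case: (IM a b).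
case: (pselect (forall a, A a -> I0 (d a))) => [dI|].
  have comm b : B b -> exists2 b', B b' & I (y * b - b' * y).
    move=> /(skew_polys AB)[m]; move: b.
    apply: (@polys_ind A m [set b | exists2 b', B b' & I (y * b - b' * y)]).
      split.
        exists 0; first by case: subspace_skew.
        by rewrite mulr0 mul0r subrr; case: sI.
      move=> c a b [a' Ba Ia] [b' Bb Ib]; exists (c *: a' + b').
        by case: subspace_skew => _ H; apply: H.
      rewrite mulrDr mulrDl opprD addrACA -scalerAr -scalerAl -scalerBr.
      by case: sI => _ H; apply: H.
    move=> i a _ Aa; exists (s a * y ^+ i).
      by apply: BM => //; apply/skew_incl/As.
    rewrite mulrA mulyE mulrDl -!mulrA -exprS -exprSr addrAC subrr add0r.
    by apply: IMr => //; case: (dI a Aa).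
  elim: n Iyn => [Iy|n IH Iy]; first by case: I_prime.
  have ev g : torus g -> exists mu : K, act g (y ^+ n) = mu *: y ^+ n.
    move=> tg; have [mu _ e] := torus_eigenvalue act_torus (skew_eigen AB) tg.
    by exists (mu ^+ n); rewrite rmorphXn /= e exprZn.
  have [] := H_prime_eigenvectors subalgebra_skew skew_torus_stable I_prime
    skew_y (By n) ev; [|by []|exact: IH].
  move=> b Bb; have [b' Bb' Ib] := comm b Bb.
  rewrite -[y * b](subrK (b' * y)) mulrDl; apply: subspaceD => //.
    exact: IMr.
  by rewrite -mulrA -exprS; apply: IMl.
move=> /existsNP[a /not_implyP[Aa nda]].
have [|i ni Hi] := @last_nonmember I0 a sI0.1 Aa; first by move=> /(_ 1%N).
case: i ni Hi => [|i] ni Hi; first by case: nda; apply: (Hi 1%N).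
(* [v] is the last derivative of [a] outside [I0]. Since [d v] is in [I0], moving a power of [y]
   past [u] leaves two terms modulo [I], the second with a q-integer as coefficient. *)
pose u := iter i d a; pose v := d u.
have Au : A u by apply: iter_der_A.
have Av : A v by apply: Ad.
have nv : ~ I0 v by [].
have dv : I0 (d v) by apply: (Hi i.+2).
pose q k := \sum_(j < k) nu ^+ j.
have q_neq0 k : q k.+1 != 0.
  have : (nu - 1) * q k.+1 != 0 by rewrite -subrX1 subr_eq0 nu_root.
  by rewrite mulf_eq0 => /norP[].
have comm k : I (y ^+ k.+1 * u -
    (iter k.+1 s u * y ^+ k.+1 + q k.+1 *: (iter k s v * y ^+ k))).
  elim: k => [|k IH].
    rewrite /q big_ord1 !scale1r mulr1 !expr1 mulyE /= subrr.
    by case: sI.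
  have Iz : I (iter k s (d v) * y ^+ k).
    by apply: IMr => //; apply: iter_s_stable => //; case: dv.
  have yu : y * (iter k.+1 s u * y ^+ k.+1) = iter k.+2 s u * y ^+ k.+2 +
      nu ^+ k.+1 *: (iter k.+1 s v * y ^+ k.+1).
    by rewrite mulrA mulyE iter_s_der mulrDl -mulrA -exprS -scalerAl.
  have yv : y * (iter k s v * y ^+ k) = iter k.+1 s v * y ^+ k.+1 +
      nu ^+ k *: (iter k s (d v) * y ^+ k).
    by rewrite mulrA mulyE iter_s_der mulrDl -mulrA -exprS -scalerAl.
  have -> : q k.+2 = q k.+1 + nu ^+ k.+1 by rewrite /q big_ord_recr.
  have := subspaceD sI (IMl _ _ skew_y IH) (subspaceZ (q k.+1 * nu ^+ k) sI Iz).
  rewrite mulrBr mulrDr -scalerAr yu yv mulrA -exprS scalerDr scalerA.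
  rewrite -!addrA !opprD !addrA subrK scalerDl -!addrA -!opprD.
  by rewrite [X in _ - (_ + X)]addrC.
have descent k c : A c -> I (c * y ^+ k) -> I0 c.
  elim: k c => [|k IH] c Ac Ic; first by split=> //; rewrite mulr1 in Ic.
  apply: contrapT => nc.
  have Asu := iter_s_A k.+1 Au.
  (* After multiplication by [t], the first of the two terms is congruent to w c y^(k+1), which is
     in [I]; what remains is a nonzero multiple of t c s^k(v) y^k. *)
  have [t [w [At Aw nt Itw]]] := left_ore_mod noethA I0_cp Ac nc (AM Ac Asu).
  have Asv := iter_s_A k Av.
  have : I0 (t * c * iter k s v).
    apply: IH; first by apply: AM => //; apply: AM.
    apply: (subspaceZ_inv sI (q_neq0 k)).
    have Itc : I (t * c * (y ^+ k.+1 * u)).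
      rewrite mulrA -(mulrA t); apply: IMr; first exact: skew_incl.
      by apply: IMl => //; apply: skew_incl.
    have Iu : I (t * c * (iter k.+1 s u * y ^+ k.+1)).
      have -> : t * c * (iter k.+1 s u * y ^+ k.+1) =
          (t * (c * iter k.+1 s u) - w * c) * y ^+ k.+1 + w * (c * y ^+ k.+1).
        by rewrite mulrBl !mulrA subrK.
      apply: subspaceD => //; last by apply: IMl => //; apply: skew_incl.
      by apply: IMr => //; case: Itw.
    have := subspaceB sI Itc (IMl _ _ (skew_incl (AM At Ac)) (comm k)).
    rewrite mulrBr opprB addrC subrK mulrDr; move/(subspace_addl sI Iu).
    by rewrite -scalerAr mulrA.
  case/I0P => //; first exact: AM.
    by case/I0P.
  move=> Iv; apply: nv; rewrite -(iter_sK k v).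
  exact: iter_si_stable.
case: I1; apply: (descent n) => //; by rewrite mul1r.
Qed.

(** The left ideals of all b with b y^n in [I] increase and become stationary. The stationary one is
    also a right ideal, because powers of [y] pass through sums of components. It multiplies y^n
    into [I], so H-primeness puts it inside [I], as y^n is not in [I]. *)
Lemma saturated_prime : left_noetherian A ->
    (forall Q, H_prime act A Q -> completely_prime A Q) -> ~ I y ->
  saturated I.
Proof.
move=> noethA CPA nIy; have [_ _ _ IM] := iI; have stA := skew_stable AB.
pose T n := [set b | B b /\ I (b * y ^+ n)].
have TS n : T n `<=` T n.+1.
  move=> b [Bb Ib]; split=> //; rewrite exprSr mulrA.
  exact: (IM _ _ skew_y Ib).2.
have [|//|n Hn] := left_noetherian_skew noethA (M := T).
  move=> n; split=> [b []//||a b Ba [Bb Ib]].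
    apply: subspaceI; [exact: subspace_skew | exact: subspace_mulr].
  split; first exact: BM.
  by rewrite -mulrA; apply: (IM _ _ Ba Ib).1.
have iT : ideal_of B (T n).
  split=> [b []//|||a b Ba [Bb Ib]].
  - by split; [case: subspace_skew | rewrite mul0r; case: sI].
  - move=> a b [Ba Ia] [Bb Ib]; split; first exact: (subspaceD subspace_skew).
    by rewrite mulrDl; apply: subspaceD.
  - split.
      by split; [exact: BM | rewrite -mulrA; apply: (IM _ _ Ba Ib).1].
    have [_ [m [k Sa]]] : cone A a by rewrite coneA.
    have [c [Sc e]] := sums_commy n sAs stA Sa.
    apply: (Hn (m + n)%N); first exact: leq_addl.
    split; first exact: BM.
    rewrite exprD -mulrA (mulrA a) e mulrA; apply: (IM _ _ _ Ib).2.
    move: Sc; apply: sums_sub => [|i _ f]; first exact: subspace_skew.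
    exact: component_B.
have stT : torus_stable act (T n).
  move=> g b tg [Bb Ib]; split; first exact: skew_torus_stable.
  have [mu mu0 e] := torus_eigenvalue act_torus (skew_eigen AB) tg.
  apply: (subspaceZ_inv sI (expf_neq0 n mu0)); rewrite scalerAr -exprZn -e.
  by rewrite -rmorphXn -rmorphM; apply: stI.
have [|TI|] :=
  H_prime_mul subalgebra_skew skew_torus_stable I_prime iT stT (By n).
- by move=> b [].
- move=> b Bb Ib; apply: TI; apply: (Hn (maxn n 1)); first exact: leq_maxl.
  by apply: (chain_le TS (leq_maxr n 1)); split.
- by move/(y_power_prime noethA CPA).
Qed.

(** If [y] is in [I] then B = A + I, hence B/I = A/(I cap A): H-primeness descends to [A] and
    complete primeness ascends to [B]. *)
Let modA b : B b -> I y -> exists2 a, A a & I (b - a).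
Proof.
move=> /(skew_polys AB)[n Pb] Iy; have [_ _ _ IM] := iI; move: b Pb.
apply: (@polys_ind A n [set b | exists2 a, A a & I (b - a)]).
  split; first by exists 0; [case: sAs | rewrite subrr; case: sI].
  move=> c a b [a' Aa' Ia] [b' Ab' Ib]; exists (c *: a' + b').
    by case: sAs => _ H; apply: H.
  by rewrite opprD addrACA -scalerBr; case: sI => _ H; apply: H.
move=> [|i] a _ Aa; first by exists a => //; rewrite mulr1 subrr; case: sI.
exists 0; first by case: sAs.
rewrite subr0 exprSr mulrA; apply: (IM _ _ _ Iy).1.
by apply: BM => //; apply: skew_incl.
Qed.

Lemma contraction_prime : I y -> H_prime act A I0.
Proof.
move=> Iy; have [_ _ I1 IP] := I_prime; have [_ _ _ IM] := iI.
split=> // [[]//|P Q iP stP iQ stQ PQ].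
have extend X : ideal_of A X -> torus_stable act X ->
    ideal_of B [set b | exists p q, [/\ X p, I q & b = p + q]].
  move=> iX stX; have [XA X0 XD XM] := iX.
  have [IB _ ID _] := iI.
  split.
  - move=> _ [p [q [Xp Iq ->]]]; apply: (subspaceD subspace_skew);
    last exact: IB.
    exact/skew_incl/XA.
  - by exists 0, 0; rewrite addr0; split=> //; case: sI.
  - move=> _ _ [p [q [Xp Iq ->]]] [p' [q' [Xp' Iq' ->]]].
    by exists (p + p'), (q + q'); rewrite addrACA; split; auto.
  - move=> b _ Bb [p [q [Xp Iq ->]]]; have [a Aa Iba] := modA Bb Iy.
    have [Xap Xpa] := XM _ _ Aa Xp; have [Ibq Iqb] := IM _ _ Bb Iq.
    have Bp : B p by apply/skew_incl/XA.
    have [Ip1 Ip2] := IM _ _ Bp Iba; split.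
    + exists (a * p), ((b - a) * p + b * q); split=> //; first exact: ID.
      by rewrite mulrBl mulrDr addrA addrCA subrr addr0.
    + exists (p * a), (p * (b - a) + q * b); split=> //; first exact: ID.
      by rewrite mulrBr mulrDl addrA addrCA subrr addr0.
have extst X : torus_stable act X ->
    torus_stable act [set b | exists p q, [/\ X p, I q & b = p + q]].
  move=> stX g _ tg [p [q [Xp Iq ->]]]; exists (act g p), (act g q).
  by rewrite linearD; split; [apply: stX | apply: stI |].
have sub X : ideal_of A X ->
    [set b | exists p q, [/\ X p, I q & b = p + q]] `<=` I -> X `<=` I0.
  move=> [XA _ _ _] le p Xp; split; last exact: XA.
  by apply: le; exists p, 0; rewrite addr0; split=> //; case: sI.
have [] := IP _ _ (extend P iP stP) (extst P stP)
  (extend Q iQ stQ) (extst Q stQ).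
- have [[PA _ _ _] [QA _ _ _]] := (iP, iQ).
  move=> _ _ [p [q [Pp Iq ->]]] [p' [q' [Qp' Iq' ->]]].
  have Bp : B p by apply/skew_incl/PA.
  have Bp' : B p' by apply/skew_incl/QA.
  rewrite mulrDl; apply: subspaceD => //.
    rewrite mulrDr; apply: subspaceD => //; first by case: (PQ p p').
    exact: (IM _ _ Bp Iq').1.
  apply: (IM _ _ _ Iq).2; apply: (subspaceD subspace_skew) => //.
  by case: iI => + _ _ _; apply.
- by move/(sub _ iP); left.
- by move/(sub _ iQ); right.
Qed.

Lemma skew_completely_prime : left_noetherian A ->
    (forall Q, H_prime act A Q -> completely_prime A Q) ->
  completely_prime B I.
Proof.
move=> noethA CPA; have [_ _ I1 _] := I_prime.
case: (pselect (I y)) => [Iy|nIy].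
  have [_ IP] := CPA _ (contraction_prime Iy); have [_ _ _ IM] := iI.
  split=> // a b Ba Bb Iab.
  have [a' Aa' Ia] := modA Ba Iy; have [b' Ab' Ib] := modA Bb Iy.
  have : I0 (a' * b').
    split; last exact: AM.
    have -> : a' * b' = a * b - (a - a') * b - a' * (b - b').
      rewrite mulrBl mulrBr !opprB [X in _ = X + _]addrC subrK.
      by rewrite [RHS]addrC subrK.
    apply: (subspaceB sI _ (IM _ _ (skew_incl Aa') Ib).1).
    by apply: (subspaceB sI _ (IM _ _ Bb Ia).2).
  case/IP => // -[I' _];
    [left; rewrite -(subrK a' a)|right; rewrite -(subrK b' b)].
    exact: subspaceD.
  exact: subspaceD.
have satI := saturated_prime noethA CPA nIy.
apply: completely_prime_saturated => //.
by apply: CPA; apply: leading_coefs_prime.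
Qed.

End Contraction.

End Skew.

(** * Comparison of two extensions *)

Section Comparison.
Variables (K : fieldType) (R : algType K) (r : nat).
Variable act : 'rV[K]_r -> {lrmorphism R -> R}.
Hypothesis act_torus : torus_action act.
Variables (h : 'rV[K]_r) (lambda : K) (y : R) (A A' B B' : set R).
Hypothesis AB : skew_extension act h lambda A B y.
Hypothesis A'A : A' `<=` A.

Lemma skew_extension_sub : subalgebra A' -> torus_stable act A' ->
    (forall a, A' a -> A' (skew_der act h y a)) ->
  skew_extension act h lambda A' (extension y A') y.
Proof.
move=> sA' stA' dA'; case: AB => th ey eh l0 l1 _ _ _ nil _ free.
split=> // [a /A'A|n a A'a Pa]; first exact: nil.
by apply: (free n a (A'A A'a)); apply: polys_sub Pa.
Qed.

Hypothesis AB' : skew_extension act h lambda A' B' y.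

Lemma component_incl P n f :
  component act h lambda A' y P n f -> component act h lambda A y P n f.
Proof.
move=> [yf [a Pa [A'a Pf]]]; split=> //; exists a => //; split;
  first exact: A'A.
exact: polys_sub Pf.
Qed.

Lemma skew_incl_B : B' `<=` B.
Proof.
move=> b /(skew_polys AB')[n Pb]; apply/(skew_polys AB); exists n.
exact: polys_sub Pb.
Qed.

(** On both sides membership is decided on components. As [h] and [lambda] are shared, a component
    over A' is a component over [A] with the same top coefficient. *)
Lemma contraction_of_leading_coefs I J :
    ideal_of B I -> torus_stable act I -> saturated B y I ->
    ideal_of B' J -> torus_stable act J -> saturated B' y J ->
    leading_coefs A' y J = leading_coefs A y I `&` A' ->
  J = I `&` B'.
Proof.
move=> iI stI satI iJ stJ satJ lcE.
have sI := ideal_subspace (subalgebra_skew AB) iI.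
have sJ := ideal_subspace (subalgebra_skew AB') iJ.
have JI n f : component act h lambda A' y A' n f -> J f <-> I f.
  move=> Cf; have [_ [a A'a ta]] := Cf.
  have lJ := ideal_components_lc act_torus AB' iJ stJ satJ Cf ta.
  have Cf' : component act h lambda A y A n f.
    exact: (component_sub A'A (component_incl Cf)).
  have ta' : top_coef A y n f a.
    by case: ta => _ Pf; split; [apply: A'A | apply: polys_sub Pf].
  have lI := ideal_components_lc act_torus AB iI stI satI Cf' ta'.
  by rewrite lJ lI lcE; split=> [[]|].
have By m : B (y ^+ m) by apply: (subalgebra_X _ (subalgebra_skew AB));
  apply: skew_y AB.
have B'y m : B' (y ^+ m).
  by apply: (subalgebra_X _ (subalgebra_skew AB')); apply: skew_y AB'.
have [[_ _ _ IM] [JB _ _ JM]] := (iI, iJ).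
apply/seteqP; split=> b.
  move=> Jb; have B'b := JB _ Jb; split=> //.
  have /(skew_polys AB')[n Pb] := B'b.
  have [m /(_ m (leqnn m))[f Cf e]] := component_decomposition act_torus AB' Pb.
  apply: (saturatedX AB satI (m := m)); first exact: skew_incl_B.
  rewrite e; apply: subspace_sum => // i _; apply/(JI _ _ (Cf i)).
  apply: (ideal_components act_torus AB' iJ stJ satJ Cf (n := n + m)%N) => //.
  by rewrite -e; case: (JM _ _ (B'y m) Jb).
move=> [Ib B'b]; have /(skew_polys AB')[n Pb] := B'b.
have [m /(_ m (leqnn m))[f Cf e]] := component_decomposition act_torus AB' Pb.
apply: (saturatedX AB' satJ (m := m)) => //.
rewrite e; apply: subspace_sum => // i _; apply/(JI _ _ (Cf i)).
have Cf' j : component act h lambda A y A j (f j).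
  exact: (component_sub A'A (component_incl (Cf j))).
apply: (ideal_components act_torus AB iI stI satI Cf' (n := n + m)%N) => //.
by rewrite -e; case: (IM _ _ (By m) Ib).
Qed.

(** Modulo multiples of [y] an element of B' reduces to its constant coefficient, which lies in
    A'. *)
Lemma contraction_of_contraction I J :
    ideal_of B I -> I y -> ideal_of B' J -> J y ->
    J `&` A' = I `&` A `&` A' ->
  J = I `&` B'.
Proof.
move=> iI Iy iJ Jy JIE.
have sI := ideal_subspace (subalgebra_skew AB) iI.
have sJ := ideal_subspace (subalgebra_skew AB') iJ.
have [[_ _ _ IM] [JB _ _ JM]] := (iI, iJ).
have split_const b : B' b ->
    exists2 a, A' a & exists2 b', B' b' & b = a + b' * y.
  have sA' := subalgebra_subspace (skew_subalgebra AB').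
  have sB' := subspace_skew AB'.
  move=> /(skew_polys AB')[n]; move: b; apply: polys_ind.
    split.
      exists 0; first by case: sA'.
      by exists 0; [case: sB' | rewrite mul0r addr0].
    move=> c a b [a1 Aa1 [a2 Ba2 ->]] [b1 Ab1 [b2 Bb2 ->]].
    exists (c *: a1 + b1); first by case: sA' => _ H; apply: H.
    exists (c *: a2 + b2); first by case: sB' => _ H; apply: H.
    by rewrite mulrDl scalerDr -scalerAl addrACA.
  move=> [|i] a _ A'a.
    exists a => //; exists 0; first by case: sB'.
    by rewrite mul0r addr0 mulr1.
  exists 0; first by case: sA'.
  exists (a * y ^+ i); last by rewrite add0r exprSr mulrA.
  have [_ _ BM] := subalgebra_skew AB'; apply: BM;
    first exact: skew_incl AB' _ A'a.
  by apply: (subalgebra_X _ (subalgebra_skew AB')); apply: skew_y AB'.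
apply/seteqP; split=> b.
  move=> Jb; have B'b := JB _ Jb; split=> //.
  have [a A'a [b' B'b' e]] := split_const b B'b.
  have Jby : J (b' * y) by case: (JM _ _ B'b' Jy).
  have : (I `&` A `&` A') a.
    by rewrite -JIE; split=> //; apply: (subspace_addr sJ Jby); rewrite -e.
  move=> [[Ia _] _]; rewrite e; apply: subspaceD => //.
  by case: (IM _ _ (skew_incl_B B'b') Iy).
move=> [Ib B'b]; have [a A'a [b' B'b' e]] := split_const b B'b.
have Iby : I (b' * y) by case: (IM _ _ (skew_incl_B B'b') Iy).
have : (J `&` A') a.
  rewrite JIE; split=> //; split; last exact: A'A.
  by apply: (subspace_addr sI Iby); rewrite -e.
by move=> [Ja _]; rewrite e; apply: subspaceD => //; case: (JM _ _ B'b' Jy).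
Qed.

End Comparison.

(** * Iterated presentations and Cauchon diagrams *)

Section Presentations.
Variables (K : fieldType) (R : algType K) (x : nat -> R) (r : nat).
Variable act : 'rV[K]_r -> {lrmorphism R -> R}.
Hypothesis act_torus : torus_action act.

Lemma subalgebra_subalg s : subalgebra (subalg x s).
Proof. exact: subalgebra_generated. Qed.

Lemma subalg_gen s k : k \in s -> subalg x s (x k).
Proof. by move=> ks; apply: subset_generated; exists k. Qed.

Lemma subalg_min s S : subalgebra S -> (forall k, k \in s -> S (x k)) ->
  subalg x s `<=` S.
Proof. by move=> sS Sx a; apply=> // _ [k ks <-]; apply: Sx. Qed.

Lemma subalg_sub s t : {subset s <= t} -> subalg x s `<=` subalg x t.
Proof.
move=> st; apply: subalg_min; first exact: subalgebra_subalg.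
by move=> k /st; apply: subalg_gen.
Qed.

Lemma subalg_stable s : (forall k, k \in s -> torus_eigenvector act (x k)) ->
  torus_stable act (subalg x s).
Proof.
move=> ex g a tg; have ss := subalgebra_subalg s.
have sss := subalgebra_subspace ss; move: a.
apply: (@subalg_min s [set a | subalg x s (act g a)]).
  split=> [|c a b /= Sa Sb|a b /= Sa Sb].
  - by rewrite /= rmorph1; case: ss.
  - by rewrite linearP; case: ss => _ H _; exact: (H c _ _ Sa Sb).
  - by rewrite rmorphM; case: ss => _ _ H; exact: (H _ _ Sa Sb).
move=> k ks /=; have [_ /(_ g tg)[mu ->]] := ex k ks.
exact: (subspaceZ mu sss (subalg_gen ks)).
Qed.

Lemma subalg_nil a : subalg x [::] a <-> exists c : K, a = c *: 1.
Proof.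
split; last first.
  move=> [c ->]; have ss := subalgebra_subalg [::].
  by apply: (subspaceZ _ (subalgebra_subspace ss)); case: ss.
move: a; apply: subalg_min => //; split.
- by exists 1; rewrite scale1r.
- by move=> c _ _ [a ->] [b ->]; exists (c * a + b); rewrite scalerDl scalerA.
- by move=> _ _ [a ->] [b ->]; exists (a * b); rewrite -scalerAl mul1r scalerA.
Qed.

Fixpoint skew_presentation (s : seq nat) : Prop :=
  if s is k :: s' then
    skew_presentation s' /\ exists h lambda,
      skew_extension act h lambda (subalg x s') (subalg x s) (x k)
  else True.

Lemma skew_extension_CGL sigma delta k s :
    torus_eigenvector act (x k) -> torus_stable act (subalg x s) ->
    skew_polynomial_ring (subalg x s) (subalg x (k :: s)) (x k)
      (sigma k) (delta k) ->
    locally_nilpotent (subalg x s) (delta k) ->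
    CGL_element x act sigma k (subalg x s) ->
  exists h lambda,
    skew_extension act h lambda (subalg x s) (subalg x (k :: s)) (x k).
Proof.
move=> ek st [auto [dA _ _] comm BE free] nil [h th [sh [lambda [eh l0 l1]]]].
have sss := subalgebra_subspace (subalgebra_subalg s).
exists h, lambda;
  have dE a : subalg x s a -> skew_der act h (x k) a = delta k a.
  by move=> Aa; rewrite /skew_der comm // sh // addrC addKr.
split=> //.
- exact: subalgebra_subalg.
- by move=> a Aa; rewrite dE //; exact: (dA a Aa).
- move=> a Aa; have [n dn] := nil a Aa; exists n; rewrite -dn.
  have A_iter m : subalg x s (iter m (delta k) a).
    by elim: m => //= m Am; exact: (dA _ Am).
  by elim: n {dn} => //= n ->; rewrite dE.
- move=> b; rewrite BE; split=> [[p Ap ->]|[n [f Pf ->]]].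
    exists (size p); rewrite horner_coef.
    by exists (fun i => p`_i * x k ^+ i) => // i; exists p`_i.
  have [c Hc] := choice (fun i => let: ex_intro2 a Aa e := Pf i in
    ex_intro (fun a => subalg x s a /\ f i = a * x k ^+ i) a (conj Aa e)).
  exists (\poly_(i < n) c i).
    move=> i; rewrite coef_poly; case: ifP => _; first by case: (Hc i).
    by case: sss.
  by rewrite horner_poly; apply: eq_bigr => i _; case: (Hc i).
- move=> n a Aa [f Pf e].
  have [c Hc] := choice (fun i => let: ex_intro2 a Aa e := Pf i in
    ex_intro (fun a => subalg x s a /\ f i = a * x k ^+ i) a (conj Aa e)).
  pose E i := if i == n then - a else c i.
  have /(congr1 (fun p : {poly R} => p`_n)) : \poly_(i < n.+1) E i = 0.
    apply: free.
      move=> i; rewrite coef_poly; case: ifP => _; last by case: sss.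
      rewrite /E; case: eqP => _; first exact: (subspaceN sss Aa).
      by case: (Hc i).
    rewrite horner_poly big_ord_recr /= {2}/E eqxx mulNr e.
    apply/eqP; rewrite subr_eq0; apply/eqP/eq_bigr => i _.
    by rewrite /E ltn_eqF //; case: (Hc i).
  by rewrite coef_poly ltnSn /E eqxx coef0 => /eqP; rewrite oppr_eq0 => /eqP.
Qed.

Lemma skew_presentation_CGL sigma delta s :
    (forall k, k \in s -> torus_eigenvector act (x k)) ->
  CGL_presentation x act sigma delta s -> skew_presentation s.
Proof.
elim: s => //= k s IH ex [Ps skew nil cgl].
have ex' j : j \in s -> torus_eigenvector act (x j).
  by move=> js; apply: ex; rewrite inE js orbT.
split; first exact: IH.
apply: skew_extension_CGL skew nil cgl; first by apply: ex; rewrite inE eqxx.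
exact: subalg_stable.
Qed.

Lemma subalg_nil_ideal Q a : ideal_of (subalg x [::]) Q -> Q a -> a != 0 -> Q 1.
Proof.
move=> iQ Qa a0; have sQ := ideal_subspace (subalgebra_subalg [::]) iQ.
have [QA _ _ _] := iQ; have /subalg_nil[c ac] := QA _ Qa.
apply: (subspaceZ_inv sQ (c := c)); last by rewrite -ac.
by apply: contra_neq a0 => c0; rewrite ac c0 scale0r.
Qed.

Lemma H_prime_nil Q a : H_prime act (subalg x [::]) Q -> Q a -> a = 0.
Proof.
move=> [iQ _ Q1 _] Qa; apply/eqP/negPn/negP => a0; apply: Q1.
exact: subalg_nil_ideal iQ Qa a0.
Qed.

Lemma left_noetherian_presentation s : skew_presentation s ->
  left_noetherian (subalg x s).
Proof.
elim: s => [_|k s IH /= [Ps [h [lambda AB]]]]; last first.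
  exact (left_noetherian_skew act_torus AB (IH Ps)).
move=> M idM chM.
case: (pselect (exists k a, M k a /\ a != 0)) => [[k [a [Ma a0]]]|M0].
  exists k => m le_km b Mb; have [MA sM MM] := idM k.
  have /subalg_nil[c ac] := MA _ Ma.
  have c0 : c != 0 by apply: contra_neq a0 => c0; rewrite ac c0 scale0r.
  have [MAm _ _] := idM m; have /subalg_nil[e ->] := MAm _ Mb.
  apply: subspaceZ => //; apply: (subspaceZ_inv sM c0); by rewrite -ac.
exists 0%N => m _ b Mb; have [_ [M00 _] _] := idM 0%N.
suff -> : b = 0 by [].
by apply/eqP/negPn/negP => b0; apply: M0; exists m, b.
Qed.

Lemma completely_prime_presentation s : skew_presentation s ->
  forall Q, H_prime act (subalg x s) Q -> completely_prime (subalg x s) Q.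
Proof.
elim: s => [_|k s IH /= [Ps [h [lambda AB]]]] Q Q_prime; last first.
  apply: (skew_completely_prime act_torus AB Q_prime).
    exact: left_noetherian_presentation.
  exact: IH.
have [[_ Q0 _ _] _ Q1 _] := Q_prime; split=> //.
move=> _ _ /subalg_nil[c ->] /subalg_nil[e ->] /(H_prime_nil Q_prime)/eqP.
rewrite -scalerAl mul1r scalerA scaler_eq0 oner_eq0 orbF mulf_eq0.
by case/orP => /eqP ->; rewrite scale0r; [left | right].
Qed.

Lemma cauchon_diagram_sub s I : cauchon_diagram x s I `<=` [set k | k \in s].
Proof.
elim: s I => [|k s IH] I //= j.
case: ifP => _; last by move/IH => /= js; rewrite inE js orbT.
by case=> [->|/IH /= js]; rewrite /= inE ?eqxx // js orbT.
Qed.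

Lemma cauchon_diagram_iota j n I :
  cauchon_diagram x (iota j n.+1) I =
    if x j \in I then
      j |` cauchon_diagram x (iota j.+1 n) (I `&` subalg x (iota j.+1 n))
    else cauchon_diagram x (iota j.+1 n)
           (leading_coefs (subalg x (iota j.+1 n)) (x j) I).
Proof. by []. Qed.

(* The same [h] and [lambda] serve both extensions, so that homogeneous
   components of the smaller one are components of the larger one. *)
Fixpoint truncated_presentation (j n : nat) : Prop :=
  if n is n'.+1 then
    truncated_presentation j.+1 n' /\ exists h lambda,
      skew_extension act h lambda
        (subalg x (iota j.+1 n)) (subalg x (iota j n.+1)) (x j) /\
      skew_extension act h lambda
        (subalg x (iota j.+1 n')) (subalg x (iota j n)) (x j)
  else True.

(** All indices in the tail diagrams exceed [j], so the presence of [j] records exactly whether x_j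
    is in the ideal. Hence [I] and [J] fall under the same case of the recursion, and the equality
    of diagrams passes to their contractions or leading coefficients. For [n = 0] both sides are the
    zero ideal of [K]. *)
Lemma diagram_determines_contraction n j I J :
    skew_presentation (iota j n.+1) -> skew_presentation (iota j n) ->
    truncated_presentation j n ->
    H_prime act (subalg x (iota j n.+1)) I ->
    H_prime act (subalg x (iota j n)) J ->
    cauchon_diagram x (iota j n) J =
      cauchon_diagram x (iota j n.+1) I `&` [set k | k \in iota j n] ->
  J = I `&` subalg x (iota j n).
Proof.
elim: n j I J => [|n IH] j I J.
  move=> _ _ _ [iI _ I1 _] J_prime _; have [[_ J0 _ _] _ _ _] := J_prime.
  have sI := ideal_subspace (subalgebra_subalg _) iI.
  apply/seteqP; split=> [a /(H_prime_nil J_prime) ->|a [Ia /subalg_nil[c ac]]].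
    split; first by case: sI.
    by case: (subalgebra_subspace (subalgebra_subalg [::])).
  suff -> : a = 0 by [].
  apply/eqP/negPn/negP => a0; apply: I1; apply: (subspaceZ_inv sI (c := c)).
    by apply: contra_neq a0 => c0; rewrite ac c0 scale0r.
  by rewrite -ac.
move=> P1 P2 [PT [h [lambda [AB AB']]]] I_prime J_prime CDE.
have Pr1 : skew_presentation (iota j.+1 n.+1) := P1.1.
have Pr2 : skew_presentation (iota j.+1 n) := P2.1.
have A'A : subalg x (iota j.+1 n) `<=` subalg x (iota j.+1 n.+1).
  by apply: subalg_sub => k; rewrite !mem_iota addnS => /andP[-> /ltnW].
have jn : j \notin iota j.+1 n by rewrite mem_iota ltnn.
have IHn := IH _ _ _ Pr1 Pr2 PT.
have [iI stI I1 _] := I_prime; have [iJ stJ J1 _] := J_prime.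
have noI := left_noetherian_presentation Pr1.
have noJ := left_noetherian_presentation Pr2.
have cpI := completely_prime_presentation Pr1.
have cpJ := completely_prime_presentation Pr2.
move: CDE; rewrite (cauchon_diagram_iota j n J) (cauchon_diagram_iota j n.+1 I).
have sub_tail (X : set R) k :
    cauchon_diagram x (iota j.+1 n) X k -> k \in iota j.+1 n.
  exact: cauchon_diagram_sub.
case: ifP => [/set_mem Jy|/negP nJy];
  case: ifP => [/set_mem Iy|/negP nIy] /seteqP[le ge].
- apply: (contraction_of_contraction AB A'A AB') => //.
  apply: IHn;
    [exact: (contraction_prime AB I_prime Iy)
    |exact: (contraction_prime AB' J_prime Jy)|].
  apply/seteqP; split=> k.
    move=> Dk; have kn := sub_tail _ _ Dk; split=> //.
    have [[ekj|//] _] := le k (or_intror Dk).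
    by move: kn jn; rewrite /= ekj => ->.
  move=> [Dk kn]; have [] := ge k; last by [].
    by split; [right | rewrite /= inE kn orbT].
  by move=> ekj; move: kn jn; rewrite /= ekj => ->.
- have [Dj _] := le j (or_introl erefl).
  have : j \in iota j.+1 n.+1 := cauchon_diagram_sub Dj.
  by rewrite mem_iota ltnn.
- have := ge j (conj (or_introl erefl) (mem_head _ _)).
  by move/sub_tail; rewrite (negbTE jn).
- have {}nIy : ~ I (x j) by move=> Iy; apply: nIy; apply: mem_set.
  have {}nJy : ~ J (x j) by move=> Jy; apply: nJy; apply: mem_set.
  have satI := saturated_prime act_torus AB I_prime noI cpI nIy.
  have satJ := saturated_prime act_torus AB' J_prime noJ cpJ nJy.
  apply: (contraction_of_leading_coefs act_torus AB A'A AB') => //.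
  apply: IHn;
    [exact: (leading_coefs_prime act_torus AB I_prime satI)
    |exact: (leading_coefs_prime act_torus AB' J_prime satJ)|].
  apply/seteqP; split=> k.
    by move=> Dk; have [Dk' _] := le k Dk; split=> //; apply: sub_tail Dk.
  move=> [Dk kn]; apply: ge; split=> //.
  by rewrite /= inE kn orbT.
Qed.

(** * Truncation of the reverse presentation *)

Definition right_polys (y : R) (U : set R) (n : nat) : set R :=
  sums (fun i => [set b | exists2 a, U a & b = y ^+ i * a]) n.

Lemma subspace_right_monomials (y : R) U i : subspace U ->
  subspace [set b : R | exists2 a, U a & b = y ^+ i * a].
Proof.
move=> [U0 UL]; split; first by exists 0; rewrite ?mulr0.
move=> c _ _ [a Ua ->] [b Ub ->]; exists (c *: a + b); first exact: UL.
by rewrite mulrDr scalerAr.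
Qed.

(** Since y^n a is s^n(a) y^n plus lower terms, freeness kills the coefficients of positive degree
    one by one from the top. *)
Lemma right_polys_base h lambda A B y U n b :
    skew_extension act h lambda A B y -> subspace U -> U `<=` A ->
    A b -> right_polys y U n b ->
  U b.
Proof.
move=> AB sU UA; have sA := subalgebra_subspace (skew_subalgebra AB).
have As a : A a -> A (act h a).
  by move=> Aa; apply: (skew_stable AB) => //; apply: skew_torus AB.
have Ad a : A a -> A (skew_der act h y a) by apply: (skew_der_stable AB).
elim: n b => [|[|n] IH] b Ab; first by move/sums0 ->; case: sU.
  by move=> /sumsS[_ [_ [/sums0 -> [a Ua ->] ->]]]; rewrite add0r mul1r.
move=> /sumsS[c [_ [Pc [a Ua ->] e]]].
have polys_c : polys y A n.+1 c.
  move: Pc; apply: sums_sub; first exact: subspace_polys.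
  move=> i lt_i _ [m Um ->]; apply: (@polys_mono _ _ _ _ (i + 1)) => //.
    by rewrite addn1.
  by apply: (y_polys i sA As Ad); apply: polys_coef => //; apply: UA.
have a0 : a = 0.
  apply: (can_inj (iter_sK act_torus AB n.+1)); rewrite (iter_s0 _ _ n.+1).
  apply: (skew_free AB (n := n.+1)); first exact: iter_s_A AB _ _ (UA _ Ua).
  have Pya : polys y A n.+1 (y ^+ n.+1 * a).
    apply: (subspace_addl (subspace_polys y n.+1 sA) polys_c); rewrite -e.
    by apply: (polys_mono sA (ltn0Sn n)); apply: polys_coef.
  rewrite -[iter _ _ _ * _](subKr (y ^+ n.+1 * a)).
  apply: (subspaceB (subspace_polys y n.+1 sA) Pya).
  exact: (commy_polys AB n.+1 (UA _ Ua)).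
by apply: IH => //; rewrite e a0 mulr0 addr0.
Qed.

(** An element is a sum of terms a x_j^i, and induction expands each a. The powers of x_j then join
    the coefficients on the right and never have to cross x_(j+n); this is the reason for right
    coefficients. *)
Lemma right_polys_presentation n j : skew_presentation (iota j n.+1) ->
  forall b, subalg x (iota j n.+1) b ->
  exists m, right_polys (x (j + n)) (subalg x (iota j n)) m b.
Proof.
elim: n j => [|n IH] j P b Bb.
  have [_ [h [lambda AB]]] := P; have /(skew_polys AB)[m Pb] := Bb.
  exists m; move: b Pb {Bb}; apply: polys_ind.
    apply: subspace_sums => i; apply: subspace_right_monomials.
    exact: subalgebra_subspace (subalgebra_subalg _).
  move=> i a lt_im Aa; apply: (sums_mem _ lt_im).
    move=> k; apply: subspace_right_monomials.
    exact: subalgebra_subspace (subalgebra_subalg _).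
  exists a => //; have /subalg_nil[c ->] := Aa.
  by rewrite addn0 -scalerAl mul1r -scalerAr mulr1.
have Pr : skew_presentation (iota j.+1 n.+1) := P.1.
have [_ [h [lambda AB]]] := P; have /(skew_polys AB)[m Pb] := Bb.
have sU := subalgebra_subspace (subalgebra_subalg (iota j n.+1)).
have sM i := @subspace_right_monomials (x (j + n.+1)) _ i sU.
move: b Pb {Bb}; apply: polys_ind.
  split; first by exists 0%N; case: (subspace_sums sM 0%N).
  move=> c a b [k Pa] [l Pb]; exists (maxn k l).
  case: (subspace_sums sM (maxn k l)) => _ H; apply: H.
    exact: (sums_mono sM (leq_maxl k l) Pa).
  exact: (sums_mono sM (leq_maxr k l) Pb).
move=> i a _ Aa; have [l Pa] := IH _ Pr a Aa; exists l.
rewrite addSnnS in Pa; move: a Pa {Aa}; apply: sums_sub.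
  exact/subspace_mulr/(subspace_sums sM).
move=> k lt_k _ [u Uu ->] /=; apply: (sums_mem sM lt_k).
exists (u * x j ^+ i); last by rewrite mulrA.
have [_ _ UM] := subalgebra_subalg (iota j n.+1).
apply: (UM u (x j ^+ i)).
  by apply: subalg_sub Uu => q qs; rewrite inE qs orbT.
apply: (subalgebra_X _ (subalgebra_subalg _)); apply: subalg_gen.
exact: mem_head.
Qed.

(** For a in A' the element x_j a - g(a) x_j lies in the larger base by the reverse presentation,
    and in [C] because its factors do. Expanded in powers of x_(N+1) with right coefficients in A',
    it is therefore constant, so it lies in A'. *)
Lemma truncate_presentation N h lambda n j :
    skew_extension act h lambda
      (subalg x (iota 1 N)) (subalg x (iota 1 N.+1)) (x N.+1) ->
    (forall k, (1 <= k <= N.+1)%N -> torus_eigenvector act (x k)) ->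
    (0 < j)%N -> (j + n)%N = N.+1 -> skew_presentation (iota j n.+1) ->
  skew_presentation (iota j n) /\ truncated_presentation j n.
Proof.
move=> FN ex; elim: n j => [//|n IH] j j0 jn P.
have Pr : skew_presentation (iota j.+1 n.+1) := P.1.
have [P' PT] := IH j.+1 isT (etrans (addSnnS _ _) jn) Pr.
have [g [mu AB]] : exists g mu, skew_extension act g mu
    (subalg x (iota j.+1 n.+1)) (subalg x (iota j n.+2)) (x j) := P.2.
set A' := subalg x (iota j.+1 n); set C := subalg x (iota 1 N).
have sA' : subalgebra A' by apply: subalgebra_subalg.
have A'A : A' `<=` subalg x (iota j.+1 n.+1).
  by apply: subalg_sub => k; rewrite !mem_iota addnS => /andP[-> /ltnW].
have A'C : A' `<=` C.
  apply: subalg_sub => k; rewrite !mem_iota addSnnS jn => /andP[jk ->].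
  by rewrite (leq_trans _ jk).
have stA' : torus_stable act A'.
  apply: subalg_stable => k; rewrite mem_iota addSnnS jn => /andP[jk kN].
  by apply: ex; rewrite (leq_trans _ jk) // ltnW.
have [_ _ CM] := skew_subalgebra FN.
have sC := subalgebra_subspace (skew_subalgebra FN).
have Cy : C (x j).
  apply: subalg_gen; rewrite mem_iota j0 add1n -jn addnS ltnS.
  exact: leq_addr.
have dA' a : A' a -> A' (skew_der act g (x j) a).
  move=> A'a.
  have [m] := right_polys_presentation Pr (skew_der_stable AB (A'A _ A'a)).
  rewrite addSnnS jn; apply: (right_polys_base FN) => //.
    exact: subalgebra_subspace.
  apply: (subspaceB sC); apply: CM => //; first exact: (A'C _ A'a).
  exact: (A'C _ (stA' g a (skew_torus AB) A'a)).
have AB' := skew_extension_sub AB A'A sA' stA' dA'.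
have BE : extension (x j) A' = subalg x (iota j n.+1).
  apply/seteqP; split.
    move=> b [m]; move: b; apply: polys_ind.
      exact: subalgebra_subspace (subalgebra_subalg _).
    have [_ _ BM] := subalgebra_subalg (iota j n.+1).
    move=> i a _ A'a; apply: (BM a (x j ^+ i)).
      by apply: subalg_sub A'a => q qs; rewrite inE qs orbT.
    apply: (subalgebra_X _ (subalgebra_subalg _)); apply: subalg_gen.
    exact: mem_head.
  apply: subalg_min; first exact: subalgebra_skew AB'.
  move=> k; rewrite inE => /orP[/eqP ->|ks]; first exact: skew_y AB'.
  by apply: (skew_incl AB'); apply: subalg_gen.
rewrite BE in AB'.
split; first by split=> //; exists g, mu.
by split=> //; exists g, mu.
Qed.

End Presentations.

Theorem theorem3p2 (K : fieldType) (K_infinite : infinite_set [set: K])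
  (R : algType K) (N : nat) (N_gt0 : (0 < N)%N) (x : nat -> R)
  (r : nat) (act : 'rV[K]_r -> {lrmorphism R -> R})
  (sigma delta : nat -> R -> R)
  (R_symCGL : symmetric_CGL_extension x N act sigma delta)
  (I J : set R)
  (I_prime : H_prime act [set: R] I)
  (J_prime : H_prime act (subalg x (forward_order N.-1)) J)
  (CD_eq : reverse_cauchon_diagram x N.-1 J =
           reverse_cauchon_diagram x N I `&` [set k | (1 <= k <= N.-1)%N]) :
  J = I `&` subalg x (forward_order N.-1).
Proof.
case: R_symCGL => -[act_torus _ genR eig fwd] [sigma' [delta' bwd]].
case: N N_gt0 genR eig fwd bwd J_prime CD_eq => // n _ genR eig fwd bwd.
have fwdE m : subalg x (forward_order m) = subalg x (iota 1 m).
  by apply/seteqP; split; apply: subalg_sub => k; rewrite mem_rev.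
rewrite /= fwdE /reverse_cauchon_diagram /reverse_order => J_prime CD_eq.
rewrite fwdE in genR; rewrite -genR in I_prime.
have eig' k : k \in forward_order n.+1 -> torus_eigenvector act (x k).
  by rewrite mem_rev mem_iota add1n ltnS => /eig.
have fwdS : forward_order n.+1 = n.+1 :: forward_order n.
  by rewrite /forward_order -[n.+1 in LHS]addn1 iotaD rev_cat.
(* The outermost forward step presents the whole algebra over the subalgebra without the last
   generator; truncation rests on it. *)
have := skew_presentation_CGL eig' fwd; rewrite fwdS => -[_ [h [lambda FN]]].
rewrite -fwdS !fwdE in FN.
have P : skew_presentation x act (iota 1 n.+1).
  apply: skew_presentation_CGL bwd => // k.
  by rewrite mem_iota add1n ltnS => /eig.
have [P' PT] := truncate_presentation act_torus FN eig (ltn0Sn 0) (add1n n) P.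
apply: (diagram_determines_contraction act_torus P P' PT I_prime J_prime).
rewrite CD_eq; congr (_ `&` _); apply/seteqP.
by split=> k /=; rewrite mem_iota add1n ltnS.
Qed.
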